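(* Let $T$ be a random piecewise linear system on $[0,1]$, given by a family $\{T_j\}_{j\in\Omega}$ and a positive probability vector $\mathbf p=(p_j)_{j\in\Omega}$, that satisfies the assumptions (A1)–(A5) listed in the context. Let $M$ be its fundamental matrix and let $\gamma=(\gamma_1,\ldots,\gamma_{N-1})^{\intercal}\in\mathbb R^{N-1}$ be a non-trivial solution of $M\gamma=0$. For $1\le m\le N-1$ define $h_m:[0,1]\to\mathbb R$ by $$h_m(x):=\sum_{\ell\in\Omega}\Big[\frac{p_\ell}{k_{m,\ell}}L_{a_{m,\ell}}(x)-\frac{p_\ell}{k_{m+1,\ell}}L_{b_{m,\ell}}(x)\Big].$$ Then the function $h_\gamma:[0,1]\to\mathbb R$, $h_\gamma(x)=\sum_{m=1}^{N-1}\gamma_m h_m(x)$, is $T$-invariant, and $h_\gamma\neq 0$ (as an element of $L^1(\lambda)$).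
   Context: Setting. $\Omega\subseteq\mathbb N$ (finite or countably infinite), $\{T_j:[0,1]\to[0,1]\}_{j\in\Omega}$ is a family of piecewise linear maps, $\mathbf p=(p_j)_{j\in\Omega}$ satisfies $p_j>0$ and $\sum_j p_j=1$. The random system $T$ applies $T_j$ with probability $p_j$. $\lambda$ is Lebesgue measure on $[0,1]$. Assumptions. (A1) The set of all critical points of the maps $T_j$, $j \in \Omega$, is finite; write $0=z_0<z_1<\cdots<z_N=1$. These points specify a common partition $\{I_i\}_{1\le i\le N}$ of $[0,1]$ into intervals, $I_i$ having endpoints $z_{i-1},z_i$ (each $z_i$, $1\le i\le N-1$, belongs to exactly one of $I_i,I_{i+1}$), such that for all $i,j$ there are real $k_{i,j}\neq0$, $d_{i,j}$ with $T_j(x)=k_{i,j}x+d_{i,j}$ for $x\in I_i$. (A2) There is $0<\rho<1$ with $\sum_{j\in\Omega}\frac{p_j}{|k_{i,j}|}\le\rho$ for each $1\le i\le N$. (A3) For each $1\le i\le N$ there is $1\le n\le N$ with $\frac{\sum_{j}\frac{p_j}{k_{i,j}}d_{i,j}}{1-\sum_j\frac{p_j}{k_{i,j}}}\neq\frac{\sum_{j}\frac{p_j}{k_{n,j}}d_{n,j}}{1-\sum_j\frac{p_j}{k_{n,j}}}$. (A4) For each $j$: $d_{1,j}=0$ if $k_{1,j}>0$ and $d_{1,j}=1$ if $k_{1,j}<0$; $d_{N,j}=1-k_{N,j}$ if $k_{N,j}>0$ and $d_{N,j}=-k_{N,j}$ if $k_{N,j}<0$. (A5) $\sum_{j\in\Omega}\frac{p_j}{k_{i,j}}\neq0$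 for each $1\le i\le N$. Notation. $\Omega^t$ is the set of words of length $t$ over $\Omega$, $\Omega^0=\{\varepsilon\}$; $\omega_1^t$ is the initial block of length $t$ of $\omega$. For $\omega=\omega_1\cdots\omega_t$, $T_\omega=T_{\omega_t}\circ\cdots\circ T_{\omega_1}$, $T_\varepsilon=\mathrm{id}$. For $y\in[0,1]$ and a word $\omega$: $\tau_\omega(y,0)=1$; for $1\le t\le|\omega|$, $\tau_\omega(y,t)=\frac{p_{\omega_t}}{k_{i,\omega_t}}$ if $T_{\omega_1^{t-1}}(y)\in I_i$; $\delta_\omega(y,t)=\prod_{n=0}^t\tau_\omega(y,n)$. $\mathbf 1_A$ is the indicator function of $A$. For $1\le n\le N$, $\mathrm{KI}_n(y)=\sum_{t\ge1}\sum_{\omega\in\Omega^t}\delta_\omega(y,t)\mathbf 1_{I_n}(T_{\omega_1^{t-1}}(y))$ (absolutely convergent by (A2)). For $1\le i\le N-1$, $j\in\Omega$: $a_{i,j}=k_{i,j}z_i+d_{i,j}$, $b_{i,j}=k_{i+1,j}z_i+d_{i+1,j}$. The fundamental matrix $M=(\mu_{n,i})$ is the $N\times(N-1)$ matrix with $\mu_{n,i}=\sum_{j\in\Omega}\big[\frac{p_j}{k_{i,j}}\mathrm{KI}_n(a_{i,j})-\frac{p_j}{k_{i+1,j}}\mathrm{KI}_n(b_{i,j})\big]+\epsilon_{n,i}$, where $\epsilon_{i,i}=\sum_j\frac{p_j}{k_{i,j}}$, $\epsilon_{i+1,i}=-\sum_j\frac{p_j}{k_{i+1,j}}$, and $\epsilon_{n,i}=0$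 otherwise. $L_y(x)=\sum_{t\ge0}\sum_{\omega\in\Omega^t}\delta_\omega(y,t)\mathbf 1_{[0,T_\omega(y))}(x)$ for $x,y\in[0,1]$. Perron–Frobenius operator: on $L^1(\lambda)$, $P_{T_j}f(x)=\sum_{y\in T_j^{-1}\{x\}}\frac{f(y)}{|T_j'(y)|}$ and $P_Tf=\sum_{j\in\Omega}p_jP_{T_j}f$. A function $h\in L^1(\lambda)$ is $T$-invariant if $P_Th=h$ $\lambda$-a.e. *)

(* Defs.v *)
From mathcomp Require Export all_boot all_order all_algebra.
From mathcomp Require Export all_classical all_reals all_analysis.
Export Order.TTheory GRing.Theory Num.Theory.
Export numFieldNormedType.Exports.

Set Implicit Arguments.
Unset Strict Implicit.
Unset Printing Implicit Defensive.

Local Open Scope classical_set_scope.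
Local Open Scope ring_scope.

(* Sum of an absolutely summable real family; the value is meaningful only if
   [summable D (EFin \o f)]. Hypotheses that assert convergence of a
   nonnegative series therefore use [\esum] in [\bar R] instead. *)
Definition sum_over (R : realType) (U : choiceType) (D : set U) (f : U -> R) : R :=
  fine (\esum_(u in D) (EFin \o f)^\+ u - \esum_(u in D) (EFin \o f)^\- u)%E.

(* The maps are total functions on [R] of which only the restriction to
   [`[0, 1]] matters, and only indices in [letters] matter. Pieces, slopes and
   offsets are numbered from 1 to [npieces], cut points from 0 to [npieces];
   [slope S i j] and [offset S i j] are k_{i,j} and d_{i,j}. *)
Record random_pl (R : realType) := RandomPL {
  letters : set nat;
  branch  : nat -> R -> R;
  prob    : nat -> R;
  npieces : nat;
  cut     : nat -> R;
  piece   : nat -> set R;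
  slope   : nat -> nat -> R;
  offset  : nat -> nat -> R }.

Section RandomPL.
Context {R : realType}.
Implicit Types (S : random_pl R) (i j m n t : nat) (x y : R) (w : seq nat).

Definition random_system S : Prop :=
  [/\ forall j, letters S j -> 0 < prob S j,
      (\esum_(j in letters S) (prob S j)%:E = 1)%E &
      forall j, letters S j -> forall x,
        x \in `[0, 1] -> branch S j x \in `[0, 1]].

Definition critical_point (f : R -> R) x : Prop :=
  ~ derivable f x 1 \/ derive1 f x = 0.

Definition interior_critical_points S : set R :=
  [set x | 0 < x < 1 /\
           exists2 j, letters S j & critical_point (branch S j) x].

(* The end points 0 and 1 are cut points by convention; the remaining ones are
   the critical points of the maps in the open unit interval. *)
Definition A1 S : Prop :=
  let N := npieces S in
  [/\ [/\ cut S 0 = 0, cut S N = 1 &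
          forall i, (i < N)%N -> cut S i < cut S i.+1],
      interior_critical_points S =
      [set cut S i | i in [set i | (1 <= i < N)%N]],
      partition [set i | (1 <= i <= N)%N] (piece S) `[0, 1]%classic /\
      (forall i, (1 <= i <= N)%N ->
         `]cut S i.-1, cut S i[%classic `<=` piece S i /\
         piece S i `<=` `[cut S i.-1, cut S i]%classic) &
      forall i j, (1 <= i <= N)%N -> letters S j ->
        slope S i j != 0 /\
        forall x, piece S i x -> branch S j x = slope S i j * x + offset S i j].

Definition A2 S : Prop :=
  exists rho : R, [/\ 0 < rho, rho < 1 &
    forall i, (1 <= i <= npieces S)%N ->
      (\esum_(j in letters S) (prob S j / `|slope S i j|)%:E <= rho%:E)%E].

Definition mean_invslope S i : R :=
  sum_over (letters S) (fun j => prob S j / slope S i j).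

Definition A3_ratio S i : R :=
  sum_over (letters S) (fun j => prob S j / slope S i j * offset S i j) /
  (1 - mean_invslope S i).

Definition A3 S : Prop :=
  forall i, (1 <= i <= npieces S)%N ->
    exists2 n, (1 <= n <= npieces S)%N & A3_ratio S i != A3_ratio S n.

Definition A4 S : Prop :=
  let N := npieces S in
  forall j, letters S j ->
    [/\ 0 < slope S 1 j -> offset S 1 j = 0,
        slope S 1 j < 0 -> offset S 1 j = 1,
        0 < slope S N j -> offset S N j = 1 - slope S N j &
        slope S N j < 0 -> offset S N j = - slope S N j].

Definition A5 S : Prop :=
  forall i, (1 <= i <= npieces S)%N -> mean_invslope S i != 0.

Definition words S t : set (seq nat) :=
  [set w | size w = t /\ forall j, j \in w -> letters S j].

(* The first letter of the word is applied first. *)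
Definition word_map S w y : R := foldl (fun x j => branch S j x) y w.

(* Letters of a word are numbered from 0 here, so [nth 0 w t] is omega_{t+1};
   under [A1] the sum has exactly one term whenever the point is in [0, 1]. *)
Definition tau S w y t : R :=
  if t is t'.+1 then
    let j := nth 0%N w t' in
    \sum_(1 <= i < (npieces S).+1 | word_map S (take t' w) y \in piece S i)
      prob S j / slope S i j
  else 1.

Definition delta S w y t : R := \prod_(0 <= n < t.+1) tau S w y n.

Definition KI S n y : R :=
  limn (fun r => \sum_(1 <= t < r) sum_over (words S t)
    (fun w => delta S w y t * \1_(piece S n) (word_map S (take t.-1 w) y))).

Definition L S y x : R :=
  limn (fun r => \sum_(0 <= t < r) sum_over (words S t)
    (fun w => delta S w y t * \1_(`[0, word_map S w y[%classic) x)).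

Definition left_value S i j : R := slope S i j * cut S i + offset S i j.
Definition right_value S i j : R := slope S i.+1 j * cut S i + offset S i.+1 j.

Definition fund_entry S n i : R :=
  sum_over (letters S) (fun j =>
    prob S j / slope S i j * KI S n (left_value S i j) -
    prob S j / slope S i.+1 j * KI S n (right_value S i j)) +
  (if n == i then mean_invslope S i
   else if n == i.+1 then - mean_invslope S i.+1 else 0).

(* Ordinals start at 0, the numbering of pieces and cut points at 1. *)
Definition fundamental_matrix S : 'M[R]_(npieces S, (npieces S).-1) :=
  \matrix_(n, i) fund_entry S n.+1 i.+1.

Definition h_fun S m x : R :=
  sum_over (letters S) (fun l =>
    prob S l / slope S m l * L S (left_value S m l) x -
    prob S l / slope S m.+1 l * L S (right_value S m l) x).

Definition h_gamma S (gamma : 'cV[R]_(npieces S).-1) x : R :=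
  \sum_(m < (npieces S).-1) gamma m 0 * h_fun S m.+1 x.

(* [derive1 f] may be junk at the cut points; this affects the operator only on a
   countable set. *)
Definition PF_map (f : R -> R) (g : R -> R) x : R :=
  \sum_(y \in `[0, 1]%classic `&` f @^-1` [set x]) g y / `|derive1 f y|.

Definition PF S (g : R -> R) x : R :=
  sum_over (letters S) (fun j => prob S j * PF_map (branch S j) g x).

Definition L1_01 (g : R -> R) : Prop :=
  (@lebesgue_measure R).-integrable `[0, 1]%classic (EFin \o g).

Definition eq_L1_01 (f g : R -> R) : Prop :=
  ae_eq (@lebesgue_measure R) `[0, 1]%classic f g.

Definition T_invariant S (g : R -> R) : Prop :=
  L1_01 g /\ eq_L1_01 (PF S g) g.

End RandomPL.

(* Main.v *)
Require Import Defs.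
From mathcomp Require Import measurable_realfun ring lra zify.

Set Implicit Arguments.
Unset Strict Implicit.
Unset Printing Implicit Defensive.

Local Open Scope classical_set_scope.
Local Open Scope ring_scope.

(** The function [h_gamma] is the tail function of a signed measure with
    countably many atoms. For a point [y] put the mass [weight w y], which is
    delta_w(y, |w|), at [T_w y] for every word [w]; the integral of [g] against
    this measure is [resolvent g y]. By absolute convergence the double series
    that define [L_y(x)] and [KI_n(y)] are such integrals, of the indicator of
    ]x, +oo[ ([L_resolvent]) and of [I_n] up to the factor
    [mean_invslope S n] ([KI_resolvent]). Let [nu] be the combination of the
    measures of all the one-sided values a_{m,j} and b_{m,j} with the
    coefficients of the theorem. Then [h_gamma gamma x] is [nu (step x)]
    ([h_gamma_nu]), and after division by the nonzero number of (A5) the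
    equations [M gamma = 0] say that [nu] gives the piece [I_n] the mass
    gamma_{n-1} - gamma_n, where gamma_0 = gamma_N = 0 ([nu_piece]).

    Invariance. Let [x] lie outside the countable set [orbit] of all images of
    the one-sided values. No end point of a piece is then a preimage of [x], so
    the operator at [x] is a sum over branches and pieces ([PF_mapE]), and it
    commutes with the integral against [nu]. What remains is the image at [x]
    of the indicator of [[0, u)]: for [u] in [I_n] it is
    sum_j p_j / k_{n,j} 1_{x < T_j u} plus a number [mean_carry] that depends
    on [u] only through [n], because an affine piece sends an interval to the
    interval between the images of its end points ([branch_step]). The first
    part is a transfer operator, of which [resolvent] is the resolvent, so it
    gives back [h_gamma] minus the direct contribution of the one-sided values
    ([nu_transfer]). The second part is integrated with the known masses of the
    pieces, and summation by parts shows that it cancels that contribution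
    ([PF_h_gamma]).

    Non-triviality. If [h_gamma] vanishes almost everywhere, then letting [x]
    tend to a cut point z_n from the appropriate side shows that [nu] gives the
    mass zero to the union of [I_{n+1}, ..., I_N] ([nu_limit]). That mass
    telescopes to gamma_n, so [gamma] is zero ([not_eq_L1_0]). *)

(** * Absolutely summable families *)

Section SumOver.
Context {R : realType}.

Local Notation asummable D f := (summable D (EFin \o f)).

Lemma asummable_le (T : choiceType) (D : set T) (f g : T -> R) :
  asummable D g -> (forall i, D i -> `|f i| <= `|g i|) -> asummable D f.
Proof.
move=> sg fg; apply: le_lt_trans sg; apply: le_esum => i Di /=.
by rewrite lee_fin; exact: fg.
Qed.

Lemma esumZl (T : choiceType) (D : set T) (f : T -> \bar R) (k : R) :
  0 <= k -> (forall i, D i -> 0 <= f i)%E ->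
  (\esum_(i in D) (k%:E * f i) = k%:E * \esum_(i in D) f i)%E.
Proof.
suff le_esumZ (c : R) (g : T -> \bar R) : 0 <= c -> (forall i, D i -> 0 <= g i)%E ->
    (\esum_(i in D) (c%:E * g i) <= c%:E * \esum_(i in D) g i)%E.
  rewrite le_eqVlt => /predU1P[<- _|k0 f0].
    by rewrite mul0e esum1// => i _; rewrite mul0e.
  apply/eqP; rewrite eq_le le_esumZ ?(ltW k0)//=.
  rewrite -[leRHS]mul1e -(divff (lt0r_neq0 k0)) EFinM -muleA.
  rewrite lee_wpmul2l ?lee_fin ?(ltW k0)//.
  apply: le_trans (le_esumZ _ _ _ _); last 2 first.
  - by rewrite invr_ge0 ltW.
  - by move=> i Di; rewrite mule_ge0 ?f0 ?lee_fin ?ltW.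
  by apply: le_esum => i Di; rewrite muleA -EFinM mulVf ?gt_eqF// mul1e.
move=> c0 g0; apply: ge_ereal_sup => _ [X [finX XD] <-].
apply: (@le_trans _ _ (c%:E * \sum_(i \in X) g i)%E).
  rewrite !fsbig_finite//= 2!big_seq ge0_sume_distrr// => i.
  by rewrite in_fset_set// inE => /XD/g0.
by rewrite lee_wpmul2l ?lee_fin// ereal_sup_ubound//; exists X.
Qed.

Lemma asummableM (T : choiceType) (D : set T) (a f : T -> R) (K : R) :
  asummable D a -> (forall i, D i -> `|f i| <= K) ->
  asummable D (fun i => a i * f i).
Proof.
move=> sa fK; apply: (@le_lt_trans _ _ (`|K|%:E * \esum_(i in D) `|(a i)%:E|)%E).
  rewrite -esumZl//; apply: le_esum => i Di /=.
  rewrite lee_fin normrM mulrC ler_wpM2r// (le_trans (fK i Di))//.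
  exact: ler_norm.
by rewrite lte_mul_pinfty ?lee_fin.
Qed.

Lemma asummableZ (T : choiceType) (D : set T) (c : R) (f : T -> R) :
  asummable D f -> asummable D (fun i => c * f i).
Proof.
move=> sf; under eq_fun do rewrite mulrC.
by apply: asummableM sf _ => i _; exact: lexx.
Qed.

Lemma asummableD (T : choiceType) (D : set T) (f g : T -> R) :
  asummable D f -> asummable D g -> asummable D (fun i => f i + g i).
Proof. by move=> sf sg; exact: (summableD sf sg). Qed.

Lemma asummableB (T : choiceType) (D : set T) (f g : T -> R) :
  asummable D f -> asummable D g -> asummable D (fun i => f i - g i).
Proof. by move=> sf sg; exact: (summableB sf sg). Qed.

Lemma asummable_sum (T : choiceType) (D : set T) (J : Type) (r : seq J)
    (P : pred J) (f : J -> T -> R) :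
  (forall j, P j -> asummable D (f j)) ->
  asummable D (fun i => \sum_(j <- r | P j) f j i).
Proof.
move=> sf; elim: r => [|j r IH].
  rewrite /summable esum1 ?ltry// => i _ /=.
  by rewrite big_nil normr0.
under eq_fun do rewrite big_cons.
case: (boolP (P j)) => // Pj.
by apply: asummableD IH; exact: sf.
Qed.

Lemma ge0_asummable (T : choiceType) (D : set T) (f : T -> R) :
  (forall i, D i -> 0 <= f i) ->
  asummable D f <-> (\esum_(i in D) (f i)%:E < +oo)%E.
Proof.
by move=> f0; rewrite /summable (@eq_esum _ _ _ _ (EFin \o f))// => i Di /=;
  rewrite ger0_norm ?f0.
Qed.

Lemma asummable_funrpos (T : choiceType) (D : set T) (f : T -> R) :
  asummable D f -> asummable D f^\+.
Proof. by rewrite -funerpos; exact: summable_funepos. Qed.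

Lemma asummable_funrneg (T : choiceType) (D : set T) (f : T -> R) :
  asummable D f -> asummable D f^\-.
Proof. by rewrite -funerneg; exact: summable_funeneg. Qed.

Lemma fin_num_esum (T : choiceType) (D : set T) (f : T -> R) :
  (forall i, D i -> 0 <= f i) -> asummable D f ->
  (\esum_(i in D) (f i)%:E \is a fin_num)%E.
Proof.
move=> f0 /(ge0_asummable f0) sf; rewrite ge0_fin_numE//.
by apply: esum_ge0 => i Di; rewrite lee_fin f0.
Qed.

(** Every decomposition into nonnegative summable families computes the sum,
    not only the one into positive and negative parts; linearity and Fubini's
    theorem reduce to [esum] through this freedom. *)
Lemma sum_over_sub (T : choiceType) (D : set T) (f g : T -> R) :
  asummable D f -> asummable D g ->
  (forall i, D i -> 0 <= f i) -> (forall i, D i -> 0 <= g i) ->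
  sum_over D (fun i => f i - g i) =
  fine (\esum_(i in D) (f i)%:E)%E - fine (\esum_(i in D) (g i)%:E)%E.
Proof.
move=> sf sg f0 g0; rewrite /sum_over.
have -> : EFin \o (fun i => f i - g i) = ((EFin \o f) \- (EFin \o g))%E by [].
rewrite esumB// fineB//; exact: fin_num_esum.
Qed.

Lemma sum_overE (T : choiceType) (D : set T) (f : T -> R) : asummable D f ->
  sum_over D f = fine (\esum_(i in D) (f^\+ i)%:E)%E -
                 fine (\esum_(i in D) (f^\- i)%:E)%E.
Proof.
move=> sf; rewrite -{1}(funrposBneg f).
apply: sum_over_sub => [||i _|i _].
- exact: asummable_funrpos.
- exact: asummable_funrneg.
- exact: funrpos_ge0.
- exact: funrneg_ge0.
Qed.

Lemma eq_sum_over (T : choiceType) (D : set T) (f g : T -> R) :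
  (forall i, D i -> f i = g i) -> sum_over D f = sum_over D g.
Proof.
move=> fg; rewrite /sum_over; congr (fine (_ - _)); apply: eq_esum => i Di.
- by rewrite !funeposE /= fg.
- by rewrite !funenegE /= fg.
Qed.

Lemma ge0_sum_over (T : choiceType) (D : set T) (f : T -> R) : asummable D f ->
  (forall i, D i -> 0 <= f i) ->
  sum_over D f = fine (\esum_(i in D) (f i)%:E)%E.
Proof.
move=> sf f0; rewrite -[RHS]subr0.
have <- : fine (\esum_(i in D) (0 : R)%:E)%E = 0 by rewrite esum1.
rewrite -sum_over_sub//; first by apply: eq_sum_over => i _; rewrite subr0.
by rewrite /summable esum1 ?ltry// => i _ /=; rewrite normr0.
Qed.

Lemma sum_over0 (T : choiceType) (D : set T) (f : T -> R) :
  (forall i, D i -> f i = 0) -> sum_over D f = 0.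
Proof.
move=> f0; rewrite (eq_sum_over f0) ge0_sum_over ?esum1//.
by rewrite /summable esum1 ?ltry// => i _ /=; rewrite normr0.
Qed.

Lemma sum_overD (T : choiceType) (D : set T) (f g : T -> R) :
  asummable D f -> asummable D g ->
  sum_over D (fun i => f i + g i) = sum_over D f + sum_over D g.
Proof.
move=> sf sg; rewrite (sum_overE sf) (sum_overE sg).
rewrite (@eq_sum_over _ _ _ (fun i => (f^\+ i + g^\+ i) - (f^\- i + g^\- i))).
  rewrite sum_over_sub; last 4 first.
  - by apply: asummableD; exact: asummable_funrpos.
  - by apply: asummableD; exact: asummable_funrneg.
  - by move=> i _; rewrite addr_ge0 ?funrpos_ge0.
  - by move=> i _; rewrite addr_ge0 ?funrneg_ge0.
  under eq_esum do rewrite EFinD.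
  under [X in _ - fine X]eq_esum do rewrite EFinD.
  rewrite !esumD; [|by move=> i _; rewrite lee_fin ?funrpos_ge0 ?funrneg_ge0..].
  rewrite !fineD; [|by apply: fin_num_esum => [i _|]; rewrite ?funrpos_ge0
    ?funrneg_ge0//; first [exact: asummable_funrpos|exact: asummable_funrneg]..].
  by rewrite opprD addrACA.
by move=> i _; have := funrDB f g => /(congr1 (@^~ i)).
Qed.

Lemma sum_overN (T : choiceType) (D : set T) (f : T -> R) : asummable D f ->
  sum_over D (fun i => - f i) = - sum_over D f.
Proof.
move=> sf; apply/eqP; rewrite -addr_eq0 -sum_overD//.
  by rewrite sum_over0// => i _; rewrite addNr.
by apply: asummable_le sf _ => i _; rewrite normrN.
Qed.

Lemma sum_overB (T : choiceType) (D : set T) (f g : T -> R) :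
  asummable D f -> asummable D g ->
  sum_over D (fun i => f i - g i) = sum_over D f - sum_over D g.
Proof.
move=> sf sg; rewrite sum_overD// ?sum_overN//.
by apply: asummable_le sg _ => i _; rewrite normrN.
Qed.

Lemma sum_overZ (T : choiceType) (D : set T) (c : R) (f : T -> R) :
  asummable D f -> sum_over D (fun i => c * f i) = c * sum_over D f.
Proof.
wlog c0 : c / 0 <= c => [hw sf|sf].
  have [c0|/ltW c0] := leP 0 c; first exact: hw.
  rewrite -[c]opprK mulNr -hw// ?oppr_ge0// -sum_overN; last exact: asummableZ.
  by apply: eq_sum_over => i _; rewrite mulNr.
rewrite (sum_overE sf).
rewrite (@eq_sum_over _ _ _ (fun i => c * f^\+ i - c * f^\- i)); last first.
  move=> i _; rewrite -mulrBr; congr (_ * _).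
  by have := funrposBneg f => /(congr1 (@^~ i)).
rewrite sum_over_sub; last 4 first.
- exact/asummableZ/asummable_funrpos.
- exact/asummableZ/asummable_funrneg.
- by move=> i _; rewrite mulr_ge0 ?funrpos_ge0.
- by move=> i _; rewrite mulr_ge0 ?funrneg_ge0.
under eq_esum do rewrite EFinM.
under [X in _ - fine X]eq_esum do rewrite EFinM.
rewrite !esumZl//; [|by move=> i _; rewrite lee_fin ?funrpos_ge0 ?funrneg_ge0..].
rewrite !fineM ?mulrBr//; apply: fin_num_esum => [i _|];
  by rewrite ?funrpos_ge0 ?funrneg_ge0//;
  first [exact: asummable_funrpos|exact: asummable_funrneg].
Qed.

Lemma norm_sum_over (T : choiceType) (D : set T) (f : T -> R) (M : R) :
  (\esum_(i in D) `|(f i)%:E| <= M%:E)%E -> `|sum_over D f| <= M.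
Proof.
move=> fM; have sf : asummable D f by exact: le_lt_trans fM (ltry _).
have sp := asummable_funrpos sf; have sn := asummable_funrneg sf.
rewrite (sum_overE sf) (le_trans (ler_normB _ _))//.
rewrite !ger0_norm ?fine_ge0 ?esum_ge0//;
  [|by move=> i _; rewrite lee_fin ?funrpos_ge0 ?funrneg_ge0..].
rewrite -fineD; [|by apply: fin_num_esum => // i _; rewrite ?funrpos_ge0
   ?funrneg_ge0..].
rewrite -esumD; [|by move=> i _; rewrite lee_fin ?funrpos_ge0 ?funrneg_ge0..].
rewrite (@eq_esum _ _ _ _ (fun i => `|(f i)%:E|)%E).
  rewrite -lee_fin fineK// fin_numElt (le_lt_trans fM (ltry _)) andbT.
  by rewrite (lt_le_trans (ltNyr 0))// esum_ge0.
move=> i _; rewrite -EFinD /=; congr EFin.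
by have := funrposDneg f => /(congr1 (@^~ i)).
Qed.

Lemma norm_sum_overM (T : choiceType) (D : set T) (a f : T -> R) (A K : R) :
  0 <= K -> (\esum_(i in D) `|(a i)%:E| <= A%:E)%E ->
  (forall i, D i -> `|f i| <= K) ->
  `|sum_over D (fun i => a i * f i)| <= K * A.
Proof.
move=> K0 aA fK; apply: norm_sum_over.
apply: (@le_trans _ _ (K%:E * \esum_(i in D) `|(a i)%:E|)%E).
  rewrite -esumZl//; apply: le_esum => i Di /=.
  by rewrite lee_fin normrM mulrC ler_wpM2r// fK.
by rewrite EFinM lee_wpmul2l.
Qed.

Lemma sum_over_fin (T : finType) (f : T -> R) :
  sum_over [set: T] f = \sum_t f t.
Proof.
have finT : finite_set [set: T] by exact: finite_finset.
have sf (g : T -> R) : asummable [set: T] g.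
  rewrite /summable esum_fset//.
  by rewrite fsbig_finite//= sumEFin ltry.
have fE (g : T -> R) : (forall t, 0 <= g t) ->
    fine (\esum_(t in [set: T]) (g t)%:E) = \sum_t g t.
  move=> g0; rewrite esum_fset// => [|t _]; last by rewrite lee_fin.
  rewrite fsbig_finite//= sumEFin /=.
  rewrite (perm_big (index_enum T))//.
  apply: uniq_perm => [||t]; [exact: finmap.fset_uniq|exact: index_enum_uniq|].
  by rewrite mem_index_enum in_fset_set// mem_setT.
rewrite sum_overE// !fE//.
rewrite -sumrB; apply: eq_bigr => t _.
by have := funrposBneg f => /(congr1 (@^~ t)).
Qed.

Lemma sum_over_bij (T T' : choiceType) (P : set T) (Q : set T') (e : T -> T')
    (f : T' -> R) :
  set_bij P Q e -> sum_over Q f = sum_over P (fun i => f (e i)).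
Proof.
move=> PQ; rewrite /sum_over; congr (fine (_ - _)%E);
  rewrite (reindex_esum P Q e)//; apply: eq_esum => i _; by rewrite ?funeposE ?funenegE.
Qed.

Lemma asummable_bij (T T' : choiceType) (P : set T) (Q : set T') (e : T -> T')
    (f : T' -> R) :
  set_bij P Q e -> asummable P (fun i => f (e i)) <-> asummable Q f.
Proof. by move=> PQ; rewrite /summable (reindex_esum P Q e)//. Qed.

Lemma esum_pair (T T' : choiceType) (D : set T) (E : set T')
    (f : T * T' -> \bar R) :
  (forall i j, D i -> E j -> 0 <= f (i, j))%E ->
  (\esum_(k in D `*` E) f k = \esum_(i in D) \esum_(j in E) f (i, j))%E.
Proof.
move=> f0; rewrite (esum_esum (J := fun=> E)) //.
have -> : D `*`` (fun=> E) = D `*` E by [].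
by apply: eq_esum => -[].
Qed.

Lemma asummable_pair (T T' : choiceType) (D : set T) (E : set T')
    (a : T -> R) (b : T * T' -> R) (K : R) :
  0 <= K -> asummable D a ->
  (forall i, D i -> \esum_(j in E) `|(b (i, j))%:E| <= K%:E)%E ->
  asummable (D `*` E) (fun k => a k.1 * b k).
Proof.
move=> K0 sa bK; rewrite /summable esum_pair//=.
apply: (@le_lt_trans _ _ (K%:E * \esum_(i in D) `|(a i)%:E|)%E).
  rewrite -esumZl//; apply: le_esum => i Di.
  under eq_esum do rewrite normrM EFinM.
  by rewrite esumZl//= muleC lee_wpmul2r ?lee_fin//; exact: bK.
by rewrite lte_mul_pinfty.
Qed.

(** Fubini's theorem: apply the theorem for nonnegative families to the
    positive and the negative part. *)
Lemma sum_over_pair (T T' : choiceType) (D : set T) (E : set T')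
    (f : T * T' -> R) :
  asummable (D `*` E) f ->
  sum_over (D `*` E) f = sum_over D (fun i => sum_over E (fun j => f (i, j))).
Proof.
move=> sf.
have sp := asummable_funrpos sf; have sn := asummable_funrneg sf.
have inner (g : T * T' -> R) : (forall k, 0 <= g k) ->
    asummable (D `*` E) g -> forall i, D i -> asummable E (fun j => g (i, j)).
  move=> g0 /(ge0_asummable (fun k _ => g0 k)); rewrite esum_pair//; last first.
    by move=> i j _ _; rewrite lee_fin.
  move=> lty i Di; apply/ge0_asummable => //.
  apply: le_lt_trans lty; apply: esum_ge; exists [set i].
    by split => //= _ ->.
  by rewrite fsbig_set1.
have outer (g : T * T' -> R) : (forall k, 0 <= g k) ->
    asummable (D `*` E) g -> (\esum_(k in D `*` E) (g k)%:E =
      \esum_(i in D) (fine (\esum_(j in E) (g (i, j))%:E))%:E)%E.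
  move=> g0 sg; rewrite esum_pair//; last by move=> i j _ _; rewrite lee_fin.
  apply: eq_esum => i Di; rewrite fineK// fin_num_esum//.
  exact: inner.
have souter (g : T * T' -> R) : (forall k, 0 <= g k) ->
    asummable (D `*` E) g ->
    asummable D (fun i => fine (\esum_(j in E) (g (i, j))%:E)%E).
  move=> g0 sg; apply/ge0_asummable.
    by move=> i _; rewrite fine_ge0// esum_ge0// => j _; rewrite lee_fin.
  rewrite -outer//.
  by case: (ge0_asummable (fun k (_ : (D `*` E) k) => g0 k)) => + _; apply.
rewrite sum_overE// !outer//.
rewrite -sum_over_sub; first last.
- by move=> i _; rewrite fine_ge0// esum_ge0// => j _; rewrite lee_fin funrneg_ge0.
- by move=> i _; rewrite fine_ge0// esum_ge0// => j _; rewrite lee_fin funrpos_ge0.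
- by apply: souter => //; exact: funrneg_ge0.
- by apply: souter => //; exact: funrpos_ge0.
apply: eq_sum_over => i Di; rewrite -sum_over_sub; first last.
- by move=> j _; rewrite funrneg_ge0.
- by move=> j _; rewrite funrpos_ge0.
- by apply: (inner f^\-) => //; exact: funrneg_ge0.
- by apply: (inner f^\+) => //; exact: funrpos_ge0.
apply: eq_sum_over => j _.
by have := funrposBneg f => /(congr1 (@^~ (i, j))).
Qed.

Lemma set_bij_swap (T T' : Type) (D : set T) (E : set T') :
  set_bij (D `*` E) (E `*` D) (fun k => (k.2, k.1)).
Proof.
split=> [[i j] []//|[i j] [i' j'] _ _ [-> ->]//|[j i] [Ej Di]].
by exists (i, j).
Qed.

(** The form of Fubini's theorem by which countable linear combinations pass
    through an integral against a measure with countably many atoms. *)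
Lemma exchange_sum_over (T T' : choiceType) (D : set T) (E : set T')
    (a : T -> R) (b : T' -> R) (f : T -> T' -> R) (K : R) :
  asummable D a -> asummable E b ->
  (forall i j, D i -> E j -> `|f i j| <= K) ->
  sum_over D (fun i => a i * sum_over E (fun j => b j * f i j)) =
  sum_over E (fun j => b j * sum_over D (fun i => a i * f i j)).
Proof.
move=> sa sb fK.
pose F k := a k.1 * (b k.2 * f k.1 k.2).
have fin_b : (\esum_(j in E) `|(b j)%:E| \is a fin_num)%E.
  rewrite ge0_fin_numE ?esum_ge0//.
have sF : asummable (D `*` E) F.
  apply: (@asummable_pair _ _ _ _ _ (fun k => b k.2 * f k.1 k.2)
           (`|K| * fine (\esum_(j in E) `|(b j)%:E|)%E)) => //.
    by rewrite mulr_ge0// fine_ge0// esum_ge0.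
  move=> i Di; rewrite EFinM fineK// -esumZl//.
  apply: le_esum => j Ej /=; rewrite lee_fin normrM mulrC ler_wpM2r//.
  by rewrite (le_trans (fK i j Di Ej))// ler_norm.
have sb' i : D i -> asummable E (fun j => b j * f i j).
  by move=> Di; apply: asummableM sb _ => j Ej; exact: fK.
have sa' j : E j -> asummable D (fun i => a i * f i j).
  by move=> Ej; apply: asummableM sa _ => i Di; exact: fK.
transitivity (sum_over (D `*` E) F).
  rewrite sum_over_pair//; apply: eq_sum_over => i Di.
  by rewrite -sum_overZ//; exact: sb'.
rewrite (sum_over_bij _ (set_bij_swap E D)) sum_over_pair/=; last first.
  by apply/(asummable_bij F (set_bij_swap E D)).
apply: eq_sum_over => j Ej; rewrite -sum_overZ; last exact: sa'.
by apply: eq_sum_over => i Di; rewrite /F/= mulrCA.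
Qed.

(** * Limits and measurability of sums *)

Lemma esum_subset (T : choiceType) (D' D : set T) (f : T -> \bar R) :
  D' `<=` D -> (forall i, D i -> 0 <= f i)%E ->
  (\esum_(i in D') f i <= \esum_(i in D) f i)%E.
Proof.
move=> D'D f0; rewrite (@esumID _ _ D' D f f0) setIidr// leeDl// esum_ge0// => i [Di _].
exact: f0.
Qed.

Lemma asummable_subset (T : choiceType) (D' D : set T) (f : T -> R) :
  D' `<=` D -> asummable D f -> asummable D' f.
Proof. by move=> D'D; apply: le_lt_trans; exact: esum_subset. Qed.

Lemma sum_overD1 (T : choiceType) (D : set T) (x : T) (f : T -> R) : D x ->
  asummable D f -> sum_over D f = f x + sum_over (D `&` ~` [set x]) f.
Proof.
move=> Dx sf.
have sub : D `&` ~` [set x] `<=` D by move=> i [].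
have pos (g : T -> R) : (forall i, 0 <= g i) -> asummable D g ->
    fine (\esum_(i in D) (g i)%:E)%E =
    g x + fine (\esum_(i in D `&` ~` [set x]) (g i)%:E)%E.
  move=> g0 sg; have g0' i : D i -> (0 <= (g i)%:E)%E by rewrite lee_fin.
  rewrite (@esumID _ _ [set x] D _ g0') setIidr => [|_ -> //].
  rewrite esum_set1 ?lee_fin// fineD// fin_num_esum//.
  exact: asummable_subset sg.
rewrite sum_overE// sum_overE; last exact: asummable_subset sf.
rewrite !pos; last 4 first.
- exact: funrneg_ge0.
- exact: asummable_funrneg.
- exact: funrpos_ge0.
- exact: asummable_funrpos.
by rewrite -[in X in _ = X + _](funrposBneg f) opprD addrACA.
Qed.

Lemma asummable_fin (T : finType) (f : T -> R) : asummable [set: T] f.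
Proof.
have finT : finite_set [set: T] by exact: finite_finset.
by rewrite /summable esum_fset// fsbig_finite//= sumEFin ltry.
Qed.

(** Dominated convergence: all but a small part of the mass of [a] sits on a
    finite set of indices, where the convergence of [f] is uniform. *)
Lemma cvg_sum_over0 (T : choiceType) (D : set T) (a : T -> R)
    (f : nat -> T -> R) (K : R) :
  asummable D a -> (forall k i, D i -> `|f k i| <= K) ->
  (forall i, D i -> f^~ i @ \oo --> (0 : R)) ->
  (fun k => sum_over D (fun i => a i * f k i)) @ \oo --> (0 : R).
Proof.
move=> sa fK f0.
wlog K0 : K fK / 0 <= K.
  move=> hw; apply: (hw `|K|) => // k i Di.
  by rewrite (le_trans (fK k i Di))// ler_norm.
have finA : (\esum_(i in D) `|(a i)%:E| \is a fin_num)%E.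
  by rewrite ge0_fin_numE ?esum_ge0.
set A := fine (\esum_(i in D) `|(a i)%:E|)%E.
have A0 : 0 <= A by rewrite fine_ge0// esum_ge0.
apply/cvgr0Pnorm_le => e e0.
(* [eta] bounds the mass outside a finite set, [del] the values of [f k] on it;
   the terms [+ 1] only keep the divisors positive. *)
pose eta := e / 2 / (K + 1); pose del := e / 2 / (A + 1).
have eta0 : 0 < eta by rewrite !divr_gt0// ltr_wpDl.
have del0 : 0 < del by rewrite !divr_gt0// ltr_wpDl.
have [_ [X [finX XD] <-] AX] := ub_ereal_sup_adherent eta0 finA.
have tail : (\esum_(i in D `&` ~` X) `|(a i)%:E| <= eta%:E)%E.
  have := @esumID _ _ X D _ (fun i (_ : D i) => abse_ge0 (a i)%:E).
  rewrite setIidr// => AE; move: AX; rewrite -[ereal_sup _]/(esum D _) AE.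
  rewrite -esum_fset//.
  set s := esum X _; set u := esum _ _.
  have fs : s \is a fin_num.
    rewrite ge0_fin_numE ?esum_ge0//; apply: le_lt_trans sa.
    exact: esum_subset.
  have fu : u \is a fin_num.
    rewrite ge0_fin_numE ?esum_ge0//; apply: le_lt_trans sa.
    by apply: esum_subset => // i [].
  move: fs fu; rewrite /s /u; case: (esum X _) => // s' _.
  case: (esum _ _) => // u' _.
  by rewrite -EFinD -EFinB lte_fin lee_fin => ?; lra.
have small : \forall k \near \oo, forall i, X i -> `|f k i| <= del.
  have [s XE] : exists s : seq T, X = [set` s] by exact/finite_seqP.
  have : {in s, forall i, D i} by move=> i si; apply: XD; rewrite XE.
  rewrite {}XE; elim: s => [_|i s IH sD]; first exact: nearW.
  have /cvgr0Pnorm_le/(_ _ del0) fi : f^~ i @ \oo --> (0 : R).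
    by apply/f0/sD; rewrite mem_head.
  have fs : {in s, forall i, D i} by move=> j js; apply: sD; rewrite inE js orbT.
  near=> k => j /=; rewrite inE => /predU1P[->|js]; first by near: k.
  by move: j js; near: k; exact: IH.
near=> k; have smallk : forall i, X i -> `|f k i| <= del by near: k.
apply: (@le_trans _ _ (A * del + eta * K)); last first.
  have leA : A * del <= e / 2.
    rewrite /del mulrCA ger_pMr ?divr_gt0// ler_pdivrMr ?mul1r ?lerDl//.
    by rewrite ltr_wpDl.
  have leK : eta * K <= e / 2.
    rewrite /eta -mulrA ger_pMr ?divr_gt0// mulrC ler_pdivrMr ?mul1r ?lerDl//.
    by rewrite ltr_wpDl.
  by lra.
apply: norm_sum_over.
rewrite (@esumID _ _ X D _ (fun i (_ : D i) => abse_ge0 (a i * f k i)%:E)).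
rewrite EFinD leeD//.
  apply: (@le_trans _ _ (del%:E * \esum_(i in D `&` X) `|(a i)%:E|)%E).
    rewrite -esumZl ?(ltW del0)//; apply: le_esum => i [Di Xi] /=.
    by rewrite lee_fin normrM mulrC ler_wpM2r// smallk.
  rewrite muleC (EFinM A) lee_wpmul2r ?lee_fin ?(ltW del0)// fineK//.
  by apply: esum_subset => // i [].
apply: (@le_trans _ _ (K%:E * \esum_(i in D `&` ~` X) `|(a i)%:E|)%E).
  rewrite -esumZl//; apply: le_esum => i [Di _] /=.
  by rewrite lee_fin normrM mulrC ler_wpM2r// fK.
by rewrite muleC (EFinM eta) lee_wpmul2r ?lee_fin.
Unshelve. all: by end_near. Qed.

Lemma cvg_sum_over_bigcup (T : choiceType) (F : nat -> set T) (f : T -> R) :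
  trivIset [set: nat] F -> asummable (\bigcup_n F n) f ->
  (fun r => \sum_(0 <= t < r) sum_over (F t) f) @ \oo -->
    sum_over (\bigcup_n F n) f.
Proof.
move=> tF sf.
have sF (g : T -> R) t : asummable (\bigcup_n F n) g -> asummable (F t) g.
  by apply: asummable_subset => i Fi; exists t.
have pos (g : T -> R) : (forall i, 0 <= g i) -> asummable (\bigcup_n F n) g ->
    (fun r => \sum_(0 <= t < r) fine (\esum_(i in F t) (g i)%:E)%E) @ \oo -->
    fine (\esum_(i in \bigcup_n F n) (g i)%:E)%E.
  move=> g0 sg.
  rewrite (_ : (fun r => _) =
      fine \o (fun r => \sum_(0 <= t < r) \esum_(i in F t) (g i)%:E)%E); last first.
    apply/funext => r /=; apply: EFin_inj; rewrite fineK -?sumEFin.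
      apply: eq_bigr => t _; rewrite fineK// fin_num_esum//; exact: sF.
    rewrite sum_fin_num; apply/allP => _ /mapP[t _ ->].
    by apply: fin_num_esum => //; exact: sF.
  apply: fine_cvg; rewrite fineK; last exact: fin_num_esum.
  rewrite nneseries_sum_bigcup//.
  apply: is_cvg_nneseries => n _ _.
  by apply: esum_ge0 => i _; rewrite lee_fin.
rewrite sum_overE//.
rewrite (_ : (fun r => _) = (fun r =>
    \sum_(0 <= t < r) fine (\esum_(i in F t) (f^\+ i)%:E)%E -
    \sum_(0 <= t < r) fine (\esum_(i in F t) (f^\- i)%:E)%E)); last first.
  apply/funext => r; rewrite -sumrB; apply: eq_bigr => t _.
  by rewrite sum_overE//; exact: sF.
apply: cvgB; apply: pos.
- by move=> i; exact: funrpos_ge0.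
- exact: asummable_funrpos.
- by move=> i; exact: funrneg_ge0.
- exact: asummable_funrneg.
Qed.

(** An enumeration of the index type turns the sum into the difference of two
    series of nonnegative measurable functions. *)
Lemma measurable_sum_over (T : countType) (D : set T) (F : T -> R -> R) :
  (forall i, measurable_fun [set: R] (F i)) ->
  measurable_fun [set: R] (fun x => sum_over D (F^~ x)).
Proof.
move=> mF.
have pos (G : T -> R -> \bar R) : (forall i x, 0 <= G i x)%E ->
    (forall i, measurable_fun [set: R] (G i)) ->
    measurable_fun [set: R] (fun x => \esum_(i in D) G i x)%E.
  move=> G0 mG.
  pose H k x := oapp (G^~ x) 0%E (unpickle k : option T).
  rewrite (_ : (fun x => _) =
      fun x => (\sum_(k <oo | k \in pickle @` D) H k x)%E); last first.
    apply/funext => x; rewrite nneseries_esum; last first.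
      by move=> k _; rewrite /H; case: unpickle => /=.
    rewrite [X in _ = esum X _](_ : _ = pickle @` D); last first.
      by apply/seteqP; split => k /=; rewrite inE.
    rewrite esum_image; last by move=> i j _ _; exact: (pcan_inj pickleK).
    by apply: eq_esum => i _; rewrite /H pickleK.
  apply: ge0_emeasurable_sum => [k x _ _|k _].
    by rewrite /H; case: unpickle => /=.
  by rewrite /H; case: unpickle => [i|]/=; [exact: mG|exact: measurable_cst].
apply: measurableT_comp; first exact: fine_measurable.
apply: emeasurable_funB; apply: pos => [i x|i].
- by rewrite funeposE le_max lexx orbT.
- under eq_fun do rewrite funeposE /=.
  by apply: measurable_maxe => //; exact/measurable_EFinP.
- by rewrite funenegE le_max lexx orbT.
- under eq_fun do rewrite funenegE /=.
  apply: measurable_maxe => //; apply/measurable_EFinP.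
  exact: measurableT_comp.
Qed.

End SumOver.

Local Notation asummable D f := (summable D (EFin \o f)).

(** * Words and the resolvent of the transfer operator *)

Section RandomSystem.
Context {R : realType} {S : random_pl R}.

Local Notation N := (npieces S).
Local Notation X := (`[0, 1]%classic : set R).

(** The number p_j / k_{i,j} for the piece [i] of [u]: over the unit interval
    the sum has exactly one term. *)
Definition inv_slope (u : R) (j : nat) : R :=
  \sum_(1 <= i < N.+1 | u \in piece S i) prob S j / slope S i j.

(** Words of all lengths are summed at once, so that the double series over
    lengths and words become single sums. *)
Definition all_words : set (seq nat) :=
  [set w : seq nat | forall j, j \in w -> letters S j].

Definition weight (w : seq nat) (y : R) : R := delta S w y (size w).

(** The integral of [g] against the measure that puts the mass [weight w y]
    at [T_w y] for every word [w]. *)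
Definition resolvent (g : R -> R) (y : R) : R :=
  sum_over all_words (fun w => weight w y * g (word_map S w y)).

(** The operator whose [t]-th power is the part of [resolvent] that comes from
    the words of length [t]. *)
Definition transfer (g : R -> R) (u : R) : R :=
  sum_over (letters S) (fun j => inv_slope u j * g (branch S j u)).

(** Seen as a function of [u], the indicator of the half-line ]x, +oo[. *)
Definition step (x u : R) : R := (x < u)%R%:R.

Lemma norm_step x u : `|step x u| <= 1.
Proof. by rewrite /step; case: ltP => _; rewrite ?normr1 ?normr0. Qed.

Lemma word_map_rcons w j y :
  word_map S (rcons w j) y = branch S j (word_map S w y).
Proof. by rewrite /word_map foldl_rcons. Qed.

Lemma weight_nil y : weight [::] y = 1.
Proof. by rewrite /weight /delta big_nat1. Qed.

Lemma weight_rcons w j y :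
  weight (rcons w j) y = weight w y * inv_slope (word_map S w y) j.
Proof.
rewrite /weight /delta size_rcons big_nat_recr//=; congr (_ * _).
  apply: eq_big_nat => -[//|n] /=; rewrite ltnS => nw.
  by rewrite nth_rcons nw -cats1 takel_cat// ltnW.
by rewrite nth_rcons ltnn eqxx -cats1 takel_cat// take_size.
Qed.

Lemma all_words_bigcup : all_words = \bigcup_t words S t.
Proof.
apply/seteqP; split => [w Ww|w [t _ []//]].
by exists (size w).
Qed.

Lemma trivIset_words : trivIset [set: nat] (words S).
Proof. by move=> s t _ _ [w [[<- _] [<- _]]]. Qed.

Lemma bij_rcons (t : nat) : set_bij (words S t `*` letters S) (words S t.+1)
  (fun k => rcons k.1 k.2).
Proof.
split=> [[w j] /= [[<- Ww] Lj]|[w j] [w' j'] _ _ /= /rcons_inj[-> ->]//|].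
  split; first by rewrite size_rcons.
  by move=> i; rewrite mem_rcons inE => /predU1P[->//|]; exact: Ww.
move=> w [] /=; case/lastP: w => // w j; rewrite size_rcons => -[wt Ww].
exists (w, j) => //; split => /=; last by apply: Ww; rewrite mem_rcons mem_head.
by split=> // i iw; apply: Ww; rewrite mem_rcons inE iw orbT.
Qed.

Lemma bij_rcons_all : set_bij (all_words `*` letters S)
  (all_words `&` ~` [set [::]]) (fun k => rcons k.1 k.2).
Proof.
split=> [[w j] /= [Ww Lj]|[w j] [w' j'] _ _ /= /rcons_inj[-> ->]//|].
  split; last by case: w {Ww}.
  by move=> i; rewrite mem_rcons inE => /predU1P[->//|]; exact: Ww.
move=> w [] /=; case/lastP: w => [? []//|w j Ww _].
exists (w, j) => //; split => /=; last by apply: Ww; rewrite mem_rcons mem_head.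
by move=> i iw; apply: Ww; rewrite mem_rcons inE iw orbT.
Qed.

Context (hS : random_system S) (hA1 : A1 S).
Context (rho : R) (rho0 : 0 < rho) (rho1 : rho < 1).
Context (hA2 : forall i, (1 <= i <= N)%N ->
  (\esum_(j in letters S) (prob S j / `|slope S i j|)%:E <= rho%:E)%E).

Lemma prob_gt0 j : letters S j -> 0 < prob S j.
Proof. by case: hS => + _ _; apply. Qed.

Lemma piece_cover u : X u -> exists2 i, (1 <= i <= N)%N & piece S i u.
Proof.
by case: hA1 => _ _ [[<- _ _] _] _ [i iN ui]; exists i.
Qed.

Lemma piece_unit i u : (1 <= i <= N)%N -> piece S i u -> X u.
Proof. by case: hA1 => _ _ [[<- _ _] _] _ iN ui; exists i. Qed.

Lemma piece_inj i j u : (1 <= i <= N)%N -> (1 <= j <= N)%N ->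
  piece S i u -> piece S j u -> i = j.
Proof.
case: hA1 => _ _ [[_ tI _] _] _ iN jN ui uj.
by apply: tI => //; exists u.
Qed.

Lemma branch_unit j u : letters S j -> X u -> X (branch S j u).
Proof. by case: hS => _ _ h Lj Xu; have := h _ Lj u; apply. Qed.

Lemma branchE i j u : (1 <= i <= N)%N -> letters S j -> piece S i u ->
  branch S j u = slope S i j * u + offset S i j.
Proof. by case: hA1 => _ _ _ h iN Lj; have [_] := h i j iN Lj; apply. Qed.

Lemma slope_neq0 i j : (1 <= i <= N)%N -> letters S j -> slope S i j != 0.
Proof. by case: hA1 => _ _ _ h iN Lj; have [] := h i j iN Lj. Qed.

Lemma word_map_unit w y : all_words w -> X y -> X (word_map S w y).
Proof.
elim/last_ind: w => // w j IH Ww Xy; rewrite word_map_rcons.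
apply: branch_unit; first by apply: Ww; rewrite mem_rcons mem_head.
by apply: IH => // i iw; apply: Ww; rewrite mem_rcons inE iw orbT.
Qed.

Lemma inv_slopeE i j u : (1 <= i <= N)%N -> piece S i u ->
  inv_slope u j = prob S j / slope S i j.
Proof.
move=> iN ui; rewrite /inv_slope big_mkcond (bigD1_seq i)/= ?iota_uniq//; last first.
  by rewrite mem_index_iota ltnS.
rewrite mem_set// big_seq_cond big1 ?addr0// => k.
rewrite mem_index_iota ltnS => /andP[kN ki]; case: ifPn => // /set_mem uk.
by move: ki; rewrite (piece_inj kN iN uk ui) eqxx.
Qed.

Lemma esum_inv_slope u : X u ->
  (\esum_(j in letters S) `|(inv_slope u j)%:E| <= rho%:E)%E.
Proof.
move=> /piece_cover[i iN ui]; apply: le_trans (hA2 iN); apply: le_esum => j Lj.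
by rewrite (inv_slopeE _ iN ui) lee_fin normrM normfV gtr0_norm ?prob_gt0.
Qed.

Lemma asummable_inv_slope u : X u -> asummable (letters S) (inv_slope u).
Proof. by move=> Xu; apply: le_lt_trans (esum_inv_slope Xu) (ltry _). Qed.

(** Words of length [t.+1] extend words of length [t] by one letter, which by
    (A2) costs a factor [rho] wherever the current point is. *)
Lemma esum_words t y : X y ->
  (\esum_(w in words S t) `|(weight w y)%:E| <= (rho ^+ t)%:E)%E.
Proof.
move=> Xy; elim: t => [|t IH].
  rewrite (_ : words S 0 = [set [::]]); last first.
    by apply/seteqP; split => [w [/size0nil-> _]//|_ ->]; split.
  by rewrite esum_set1// weight_nil /= normr1.
rewrite (reindex_esum _ _ _ _ (bij_rcons t)) esum_pair//=.
apply: (@le_trans _ _ (rho%:E * \esum_(w in words S t) `|(weight w y)%:E|)%E).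
  rewrite -esumZl ?(ltW rho0)//; apply: le_esum => w [_ Ww].
  under eq_esum do rewrite weight_rcons normrM EFinM.
  rewrite esumZl//= muleC lee_wpmul2r ?lee_fin//.
  by apply: esum_inv_slope; exact: word_map_unit.
by rewrite exprS EFinM lee_wpmul2l ?lee_fin ?(ltW rho0).
Qed.

Definition resolvent_bound : R := (1 - rho)^-1.

Lemma resolvent_bound_ge0 : 0 <= resolvent_bound.
Proof. by rewrite invr_ge0 subr_ge0 ltW. Qed.

(** Geometric series. *)
Lemma esum_all_words y : X y ->
  (\esum_(w in all_words) `|(weight w y)%:E| <= resolvent_bound%:E)%E.
Proof.
move=> Xy; rewrite all_words_bigcup nneseries_sum_bigcup//; last exact: trivIset_words.
apply: lime_le; first by apply: is_cvg_nneseries => n _ _; apply: esum_ge0.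
apply: nearW => r.
apply: (@le_trans _ _ (\sum_(0 <= t < r) (rho ^+ t)%:E)%E).
  by apply: lee_sum => t _; exact: esum_words.
rewrite sumEFin lee_fin /resolvent_bound big_mkord.
rewrite -[leRHS]mul1r ler_pdivlMr ?subr_gt0//.
have := subrX1 rho r; have : 0 <= rho ^+ r by rewrite exprn_ge0 ?(ltW rho0).
by set s := \sum_(_ < _) _ => ? ?; lra.
Qed.

Lemma asummable_weight y : X y -> asummable all_words (weight^~ y).
Proof. by move=> Xy; apply: le_lt_trans (esum_all_words Xy) (ltry _). Qed.

Lemma asummable_resolvent (g : R -> R) (K y : R) : X y ->
  (forall u, X u -> `|g u| <= K) ->
  asummable all_words (fun w => weight w y * g (word_map S w y)).
Proof.
move=> Xy gK; apply: (asummableM (K := K)); first exact: asummable_weight.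
by move=> w Ww; apply/gK/word_map_unit.
Qed.

Lemma norm_resolvent (g : R -> R) (K y : R) : X y -> (forall u, X u -> `|g u| <= K) ->
  `|resolvent g y| <= K * resolvent_bound.
Proof.
move=> Xy gK; apply: norm_sum_overM; last first.
- by move=> w Ww; apply/gK/word_map_unit.
- exact: esum_all_words.
- by rewrite (le_trans _ (gK y Xy)).
Qed.

Lemma bounded_transfer (g : R -> R) (K u : R) : X u ->
  (forall u, X u -> `|g u| <= K) -> `|transfer g u| <= K * rho.
Proof.
move=> Xu gK; apply: norm_sum_overM.
- by rewrite (le_trans _ (gK u Xu)).
- exact: esum_inv_slope.
- by move=> j Lj; apply/gK/branch_unit.
Qed.

(** Appending one letter to every word produces all words but the empty one,
    whose contribution to [resolvent g y] is [g y]. *)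
Lemma resolvent_transfer (g : R -> R) (K y : R) : X y ->
  (forall u, X u -> `|g u| <= K) -> resolvent (transfer g) y = resolvent g y - g y.
Proof.
move=> Xy gK.
have sresolvent := asummable_resolvent Xy gK.
have sresolvent' : asummable (all_words `&` ~` [set [::]])
    (fun w => weight w y * g (word_map S w y)).
  by apply: asummable_subset sresolvent => w [].
rewrite /resolvent [in RHS](sum_overD1 (x := [::]))// weight_nil mul1r.
rewrite addrC addrA addNr add0r.
rewrite (sum_over_bij _ bij_rcons_all) sum_over_pair/=; last first.
  by apply/(asummable_bij (fun w => weight w y * g (word_map S w y)) bij_rcons_all).
apply: eq_sum_over => w Ww; rewrite -sum_overZ; last first.
  apply: (asummableM (K := K)).
    by apply: asummable_inv_slope; exact: word_map_unit.
  by move=> j Lj; apply/gK/branch_unit => //; exact: word_map_unit.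
by apply: eq_sum_over => j Lj; rewrite weight_rcons word_map_rcons mulrA.
Qed.

Lemma resolvent_cvg (g : R -> R) (K y : R) : X y -> (forall u, X u -> `|g u| <= K) ->
  (fun r => \sum_(0 <= t < r) sum_over (words S t)
     (fun w => weight w y * g (word_map S w y))) @ \oo --> resolvent g y.
Proof.
move=> Xy gK; rewrite /resolvent all_words_bigcup; apply: cvg_sum_over_bigcup.
  exact: trivIset_words.
by rewrite -all_words_bigcup; exact: asummable_resolvent gK.
Qed.

Lemma L_resolvent x y : X x -> X y ->
  L S y x = resolvent (step x) y.
Proof.
move=> Xx Xy; rewrite /L; apply: cvg_lim => //.
rewrite (_ : (fun r => _) = fun r => \sum_(0 <= t < r) sum_over (words S t)
    (fun w => weight w y * step x (word_map S w y))).
  by apply: (resolvent_cvg (K := 1)) => // u _; exact: norm_step.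
apply/funext => r; apply: eq_bigr => t _; apply: eq_sum_over => w [<- Ww].
rewrite /weight /step indicE; congr (_ * _%:R).
by move: Xx; rewrite mem_setE /= !in_itv /= => /andP[-> _].
Qed.

(** The factor of the last letter depends only on the piece that contains the
    point before it, so on [I_n] that letter sums to [mean_invslope S n]. *)
Lemma KI_resolvent n y : (1 <= n <= N)%N -> X y ->
  KI S n y = mean_invslope S n * resolvent (\1_(piece S n)) y.
Proof.
move=> nN Xy; rewrite /KI; apply: cvg_lim => //.
have ind1 u : X u -> `|\1_(piece S n) u| <= 1 :> R.
  by move=> _; rewrite indicE; case: (_ \in _); rewrite ?normr1 ?normr0.
rewrite -cvg_shiftS /=.
rewrite (_ : (fun r => _) = fun r => mean_invslope S n *
    \sum_(0 <= t < r) sum_over (words S t)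
    (fun w => weight w y * \1_(piece S n) (word_map S w y))).
  by apply: cvgMr; exact: (resolvent_cvg (K := 1)).
apply/funext => r; rewrite big_add1 /= big_distrr/=; apply: eq_bigr => t _.
have wt_sub : words S t `<=` all_words.
  by rewrite all_words_bigcup => w tw; exists t.
rewrite -sum_overZ; last exact: asummable_subset wt_sub (asummable_resolvent Xy ind1).
rewrite (sum_over_bij _ (bij_rcons t)).
pose F k := weight k.1 y * (inv_slope (word_map S k.1 y) k.2 *
                            \1_(piece S n) (word_map S k.1 y)).
rewrite (@eq_sum_over _ _ _ _ F); last first.
  move=> [w j] [[/= <- Ww] Lj]; rewrite /F/= -cats1 take_size_cat// cats1.
  by rewrite -(size_rcons w j) -/(weight _ _) weight_rcons mulrA.
rewrite sum_over_pair; last first.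
  apply: (@asummable_pair _ _ _ _ _ (weight^~ y) (fun k =>
    inv_slope (word_map S k.1 y) k.2 * \1_(piece S n) (word_map S k.1 y)) rho).
  - exact: ltW.
  - exact: asummable_subset wt_sub (asummable_weight Xy).
  move=> w /wt_sub Ww /=; have Xw := word_map_unit Ww Xy.
  apply: le_trans (esum_inv_slope Xw); apply: le_esum => j Lj.
  by rewrite lee_fin normrM ler_piMr// ind1.
apply: eq_sum_over => w /wt_sub Ww; have Xw := word_map_unit Ww Xy.
rewrite /F/= sum_overZ; last first.
  apply: (asummableM (K := 1)); first exact: asummable_inv_slope.
  by move=> j _; exact: ind1.
rewrite mulrCA; congr (_ * _); rewrite indicE.
case: (boolP (_ \in _)) => [/set_mem wn|_]; last first.
  by rewrite mulr0; under eq_sum_over do rewrite mulr0; exact: sum_over0.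
rewrite mulr1; apply: eq_sum_over => j _.
by rewrite mulr1 (inv_slopeE _ nN).
Qed.

(** * One-sided values at the cut points *)

Lemma piece_itv i : (1 <= i <= N)%N ->
  `]cut S i.-1, cut S i[%classic `<=` piece S i /\
  piece S i `<=` `[cut S i.-1, cut S i]%classic.
Proof. by case: hA1 => _ _ [_ h] _; exact: h. Qed.

Lemma cut_lt i : (i < N)%N -> cut S i < cut S i.+1.
Proof. by case: hA1 => -[_ _ h] _ _ _; exact: h. Qed.

(** The closed unit interval contains the limits at the end points. *)
Lemma affine_unit (s v k d : R) : s < v ->
  (forall x, s < x < v -> 0 <= k * x + d <= 1) ->
  (0 <= k * s + d <= 1) /\ (0 <= k * v + d <= 1).
Proof.
move=> sv h.
have up (k' d' a b : R) : a != b ->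
    (forall t : R, 0 < t < 1 -> k' * (a + t * (b - a)) + d' <= 1) ->
    k' * a + d' <= 1.
  move=> ab ub; rewrite leNgt; apply/negP => a1.
  have half := ub (1 / 2) ltac:(lra).
  (* At this [t] the affine function still exceeds 1 by half of what it does
     at [a]. *)
  pose t := (k' * a + d' - 1) / (2 * (k' * (a - b))).
  have den : 0 < k' * (a - b) by nra.
  have tE : t * (2 * (k' * (a - b))) = k' * a + d' - 1.
    by rewrite /t divfK// gt_eqF// mulr_gt0.
  have t01 : 0 < t < 1.
    have den2 : 0 < 2 * (k' * (a - b)) by lra.
    by rewrite divr_gt0 ?subr_gt0//= ltr_pdivrMr//; lra.
  have := ub t t01; lra.
have inside t : 0 < t < 1 -> s < s + t * (v - s) < v /\ s < v + t * (s - v) < v.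
  by move=> /andP[t0 t1]; split; apply/andP; split; nra.
have sv' := lt_eqF sv; have vs' := gt_eqF sv.
split; apply/andP; split.
- suff : (- k) * s + (1 - d) <= 1 by lra.
  apply: (up _ _ _ v); rewrite ?sv'// => t /inside[] /h + _; lra.
- by apply: (up _ _ _ v); rewrite ?sv'// => t /inside[] /h + _; lra.
- suff : (- k) * v + (1 - d) <= 1 by lra.
  apply: (up _ _ _ s); rewrite ?vs'// => t /inside[] _ /h; lra.
- by apply: (up _ _ _ s); rewrite ?vs'// => t /inside[] _ /h; lra.
Qed.

Lemma piece_ends_unit i j : (1 <= i <= N)%N -> letters S j ->
  X (slope S i j * cut S i.-1 + offset S i j) /\
  X (slope S i j * cut S i + offset S i j).
Proof.
move=> iN Lj.
have cc : cut S i.-1 < cut S i.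
  by case: i iN => // i /andP[_ iN]; exact: cut_lt.
have [] := @affine_unit (cut S i.-1) (cut S i) (slope S i j) (offset S i j) cc.
  move=> x xI; have pix : piece S i x.
    by apply: (piece_itv iN).1; rewrite /= in_itv.
  rewrite -(branchE iN Lj pix).
  by have := branch_unit Lj (piece_unit iN pix); rewrite /= in_itv.
by rewrite /= !in_itv.
Qed.

Lemma left_value_unit i j : (1 <= i <= N)%N -> letters S j -> X (left_value S i j).
Proof. by move=> iN Lj; have [] := piece_ends_unit iN Lj. Qed.

Lemma right_value_unit i j : (i < N)%N -> letters S j -> X (right_value S i j).
Proof. by move=> iN Lj; have [] := @piece_ends_unit i.+1 j iN Lj. Qed.

Lemma esum_slope i : (1 <= i <= N)%N ->
  (\esum_(j in letters S) `|(prob S j / slope S i j)%:E| <= rho%:E)%E.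
Proof.
move=> iN; apply: le_trans (hA2 iN); apply: le_esum => j Lj.
by rewrite lee_fin normrM normfV gtr0_norm ?prob_gt0.
Qed.

Lemma asummable_slope i : (1 <= i <= N)%N ->
  asummable (letters S) (fun j => prob S j / slope S i j).
Proof. by move=> iN; apply: le_lt_trans (esum_slope iN) (ltry _). Qed.

(** * The Perron-Frobenius operator outside a countable set *)

(** The values at the end points of the pieces, taken from inside the piece.
    Unlike the one-sided values of [h_gamma] they include those at 0 and 1, so
    that they contain the image of every end point under every branch. *)
Definition end_values : set R :=
  [set v | exists i j, letters S j /\
     ((1 <= i <= N)%N /\ v = left_value S i j \/
      (i < N)%N /\ v = right_value S i j)].

Definition orbit : set R :=
  [set u | exists w v, [/\ all_words w, end_values v & u = word_map S w v]].

Lemma end_values_unit : end_values `<=` X.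
Proof.
move=> v [i [j [Lj [[iN ->]|[iN ->]]]]].
- exact: left_value_unit.
- exact: right_value_unit.
Qed.

Lemma orbit_unit : orbit `<=` X.
Proof. by move=> _ [w [v [Ww /end_values_unit Xv ->]]]; exact: word_map_unit. Qed.

Lemma orbit_end v : end_values v -> orbit v.
Proof. by move=> ev; exists [::], v. Qed.

Lemma orbit_left i j : (1 <= i <= N)%N -> letters S j -> orbit (left_value S i j).
Proof. by move=> iN Lj; apply: orbit_end; exists i, j; split=> //; left. Qed.

Lemma orbit_right i j : (i < N)%N -> letters S j -> orbit (right_value S i j).
Proof. by move=> iN Lj; apply: orbit_end; exists i, j; split=> //; right. Qed.

Lemma orbit_branch u j : letters S j -> orbit u -> orbit (branch S j u).
Proof.
move=> Lj [w [v [Ww ev ->]]]; exists (rcons w j), v; split => //.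
  by move=> i; rewrite mem_rcons inE => /predU1P[->|/Ww].
by rewrite word_map_rcons.
Qed.

Lemma orbit_word_map w u : all_words w -> orbit u -> orbit (word_map S w u).
Proof.
elim/last_ind: w => // w j IH Ww ou; rewrite word_map_rcons.
apply: orbit_branch; first by apply: Ww; rewrite mem_rcons mem_head.
by apply: IH => // i iw; apply: Ww; rewrite mem_rcons inE iw orbT.
Qed.

Lemma countable_orbit : countable orbit.
Proof.
pose f (k : seq nat * (bool * nat * nat)) : R := word_map S k.1
  (if k.2.1.1 then left_value S k.2.1.2 k.2.2 else right_value S k.2.1.2 k.2.2).
apply: (@sub_countable _ _ _ (f @` setT)); last first.
  by apply: sub_countable (card_image_le f setT) _; exact: countableP.
apply: subset_card_le => _ [w [v [_ [i [j [_ [[_ ->]|[_ ->]]]]] ->]]].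
- by exists (w, (true, i, j)).
- by exists (w, (false, i, j)).
Qed.

Definition preimage (i j : nat) (x : R) : R := (x - offset S i j) / slope S i j.

Lemma preimageK i j x : (1 <= i <= N)%N -> letters S j ->
  slope S i j * preimage i j x + offset S i j = x.
Proof.
by move=> iN Lj; rewrite /preimage mulrC divfK ?subrK ?slope_neq0.
Qed.

Lemma branch_preimage i j y x : (1 <= i <= N)%N -> letters S j -> piece S i y ->
  branch S j y = x -> y = preimage i j x.
Proof.
move=> iN Lj py <-; rewrite (branchE iN Lj py) /preimage addrK mulrC mulKf//.
exact: slope_neq0.
Qed.

Lemma cut_le i k : (i <= k <= N)%N -> cut S i <= cut S k.
Proof.
move=> /andP[]; elim: k => [|k IH]; first by rewrite leqn0 => /eqP->.
rewrite leq_eqVlt => /predU1P[->//|ik] kN.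
by apply: le_trans (IH ik (ltnW kN)) (ltW (cut_lt kN)).
Qed.

(** Outside the orbit no end point of a piece is mapped to [x], so it does not
    matter which pieces own the cut points. *)
Lemma piece_preimage i j x : (i < N)%N -> letters S j -> ~ orbit x ->
  piece S i.+1 (preimage i.+1 j x) <->
  cut S i < preimage i.+1 j x < cut S i.+1.
Proof.
move=> iN Lj ox; have iN1 : (1 <= i.+1 <= N)%N by [].
split=> [/(piece_itv iN1).2|pI]; last by apply: (piece_itv iN1).1; rewrite /= in_itv.
rewrite /= in_itv /= => /andP[]; rewrite !le_eqVlt.
have pK := preimageK x iN1 Lj.
move=> /predU1P[cE|->] /predU1P[cE'|->//].
- by case: ox; rewrite -pK -cE; exact: orbit_right.
- by case: ox; rewrite -pK -cE; exact: orbit_right.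
- by case: ox; rewrite -pK cE'; exact: orbit_left.
Qed.

Lemma derive1_branch i j y : (i < N)%N -> letters S j ->
  cut S i < y < cut S i.+1 -> derive1 (branch S j) y = slope S i.+1 j.
Proof.
move=> iN Lj yI; rewrite derive1E.
have dA : is_derive y (1 : R) (fun z => slope S i.+1 j * z + offset S i.+1 j)
    (slope S i.+1 j).
  apply: is_derive_eq.
  by rewrite addr0; exact: mulr1.
have /near_eq_is_derive-/(_ _ _ dA) : \near y,
    slope S i.+1 j * y + offset S i.+1 j = branch S j y.
  have : \forall z \near y, z \in `]cut S i, cut S i.+1[.
    exact: near_in_itvoo.
  apply: filterS => z zI; rewrite (@branchE i.+1)//.
  by apply: (@piece_itv i.+1 _).1.
by move=> [_ ->].
Qed.

(** Each piece is affine, so it contains at most one preimage of [x], and that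
    preimage is interior to the piece, where the derivative is the slope. *)
Lemma PF_mapE j (g : R -> R) x : letters S j -> X x -> ~ orbit x ->
  PF_map (branch S j) g x = \sum_(i < N)
    (cut S i < preimage i.+1 j x < cut S i.+1)%R%:R *
    (g (preimage i.+1 j x) / `|slope S i.+1 j|).
Proof.
move=> Lj Xx ox; rewrite /PF_map.
pose J : set nat := [set i | (cut S i < preimage i.+1 j x < cut S i.+1)%R].
have bij : set_bij (`I_N `&` J) (X `&` branch S j @^-1` [set x])
    (fun i => preimage i.+1 j x).
  split=> [i [/= iN /(piece_preimage iN Lj ox) pi]|i k|y [Xy /= yx]].
  - have iN1 : (1 <= i.+1 <= N)%N by [].
    split; first exact: piece_unit iN1 pi.
    by rewrite /= (branchE iN1 Lj pi) preimageK.
  - move=> /set_mem[/= iN /(piece_preimage iN Lj ox) pi].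
    move=> /set_mem[/= kN /(piece_preimage kN Lj ox) pk] ik.
    by rewrite ik in pi; have [] := @piece_inj i.+1 k.+1 _ iN kN pi pk.
  have [[//|i] iN pi] := piece_cover Xy.
  have yE := branch_preimage iN Lj pi yx.
  exists i => //; split => //; rewrite yE in pi.
  exact/piece_preimage.
rewrite (reindex_fsbig _ _ _ _ bij) fsbig_mkcondr.
rewrite (@fsbig_ord _ _ _ N (fun i => (cut S i < preimage i.+1 j x < cut S i.+1)%R%:R *
    (g (preimage i.+1 j x) / `|slope S i.+1 j|))).
apply: eq_fsbigr => i /set_mem /= iN.
case: (boolP (i \in J)) => [/set_mem Ji|/negP Ji].
  by rewrite (derive1_branch iN Lj Ji) Ji mul1r.
have /negbTE -> : ~~ (cut S i < preimage i.+1 j x < cut S i.+1)%R.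
  by apply/negP => /mem_set.
by rewrite mul0r.
Qed.

(** The affine map sends the interval from [s] to [v] to the one between the
    images of [s] and [v]; the sign of the slope is accounted for by dividing by
    [k] instead of its absolute value. *)
Lemma step_affine (s v k d x : R) : k != 0 -> s <= v ->
  x != k * s + d -> x != k * v + d ->
  (s < (x - d) / k < v)%R%:R / `|k| = (step x (k * v + d) - step x (k * s + d)) / k.
Proof.
move=> k0 sv xs xv; rewrite /step.
have [kp|kn] := ltrP 0 k.
  rewrite gtr0_norm//; congr (_ / _).
  rewrite ltr_pdivlMr// ltr_pdivrMr// ltrBrDr ltrBlDr [s * k]mulrC [v * k]mulrC.
  have le : k * s + d <= k * v + d by rewrite lerD2r ler_wpM2l// ltW.
  case: (ltrP x (k * s + d)) => h1; case: (ltrP x (k * v + d)) => h2 /=;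
    rewrite ?(andbT, andbF) ?(subr0, subrr, sub0r)//.
  - by rewrite ltNge (ltW h1).
  - by move: (lt_le_trans h1 le); rewrite ltNge h2.
  - by rewrite lt_neqAle eq_sym xs h1.
have {}kn : k < 0 by rewrite lt_neqAle k0.
rewrite ltr0_norm// invrN mulrN -mulNr; congr (_ / _).
apply/eqP; rewrite eqr_oppLR opprB; apply/eqP.
rewrite ltr_ndivlMr// ltr_ndivrMr// ltrBlDr ltrBrDr [s * k]mulrC [v * k]mulrC.
have le : k * v + d <= k * s + d by rewrite lerD2r ler_wnM2l// ltW.
rewrite andbC.
case: (ltrP x (k * s + d)) => h1; case: (ltrP x (k * v + d)) => h2 /=;
  rewrite ?(andbT, andbF) ?(subr0, subrr, sub0r)//.
- by rewrite ltNge (ltW h2).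
- by rewrite lt_neqAle eq_sym xv h2.
- by move: (lt_le_trans h2 le); rewrite ltNge h1.
Qed.

(** In the image of the indicator of [[0, u)] under branch [j], with [u] in
    piece [n.+1], the part that does not depend on [u]: the whole pieces to the
    left of [u] and the left end of the piece of [u]. *)
Definition carry (n j : nat) (x : R) : R :=
  \sum_(i < n) (step x (left_value S i.+1 j) - step x (right_value S i j)) /
    slope S i.+1 j - step x (right_value S n j) / slope S n.+1 j.

(** The pieces to the left of the one of [u] count fully, its own piece up to
    [u], and those to the right not at all. *)
Lemma branch_step n j u x : (n < N)%N -> letters S j -> ~ orbit x ->
  orbit u -> piece S n.+1 u ->
  \sum_(i < N) (cut S i < preimage i.+1 j x < cut S i.+1)%R%:R /
    `|slope S i.+1 j| * step (preimage i.+1 j x) u =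
  step x (branch S j u) / slope S n.+1 j + carry n j x.
Proof.
move=> nN Lj ox ou pu.
have nN1 : (1 <= n.+1 <= N)%N by [].
have := (piece_itv nN1).2 _ pu; rewrite /= in_itv /= => /andP[un nu].
have neq v : orbit v -> x != v by move=> ov; apply/eqP => xv; rewrite xv in ox.
have hitE i s v : (i < N)%N -> s <= v ->
    orbit (slope S i.+1 j * s + offset S i.+1 j) ->
    orbit (slope S i.+1 j * v + offset S i.+1 j) ->
    (s < preimage i.+1 j x < v)%R%:R / `|slope S i.+1 j| =
    (step x (slope S i.+1 j * v + offset S i.+1 j) -
     step x (slope S i.+1 j * s + offset S i.+1 j)) / slope S i.+1 j.
  by move=> iN sv os ov; rewrite step_affine ?neq// slope_neq0.
rewrite -(big_mkord xpredT (fun i => (cut S i < preimage i.+1 j x < cut S i.+1)%R%:R /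
    `|slope S i.+1 j| * step (preimage i.+1 j x) u)).
rewrite (big_cat_nat _ (n := n))//=; last exact: ltnW.
rewrite (big_ltn nN) [X in _ + (_ + X) = _]big1_seq ?addr0; last first.
  move=> i; rewrite mem_index_iota => /andP[_ /andP[ni iN]].
  case: (boolP (_ < _ < _)%R) => [/andP[lo _]|_]; last by rewrite !mul0r.
  have : u <= preimage i.+1 j x.
    apply: le_trans nu (le_trans _ (ltW lo)); apply: cut_le.
    by rewrite ni ltnW.
  by rewrite /step => /le_gtF->; rewrite mulr0.
rewrite big_mkord /carry [RHS]addrCA; congr (_ + _).
  apply: eq_bigr => i _; have iN : (i < N)%N := ltn_trans (ltn_ord i) nN.
  transitivity ((cut S i < preimage i.+1 j x < cut S i.+1)%R%:R / `|slope S i.+1 j|).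
    case: (boolP (_ < _ < _)%R) => [/andP[_ hi]|_]; last by rewrite !mul0r.
    have : preimage i.+1 j x < u.
      apply: lt_le_trans hi (le_trans _ un); apply: cut_le.
      by rewrite ltn_ord ltnW.
    by rewrite /step => ->; rewrite mulr1.
  rewrite hitE//; first exact/ltW/cut_lt.
  - exact: orbit_right.
  - exact: orbit_left.
rewrite -mulrBl.
rewrite (branchE nN1 Lj pu) -hitE//.
- rewrite /step mulrAC -natrM mulnb; congr (_%:R / _).
  apply: congr1; apply/idP/idP.
    by move=> /andP[/andP[-> _] ->].
  by move=> /andP[-> xu]; rewrite xu (lt_le_trans xu nu).
- exact: orbit_right.
- by rewrite -(branchE nN1 Lj pu); exact: orbit_branch.
Qed.

Lemma norm_sub_step x u v : `|step x u - step x v| <= 1.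
Proof.
by rewrite /step; case: ltP => _; case: ltP => _;
  rewrite ?subrr ?subr0 ?sub0r ?normrN ?normr1 ?normr0.
Qed.

Lemma asummable_carry n x : (n < N)%N ->
  asummable (letters S) (fun j => prob S j * carry n j x).
Proof.
move=> nN; under eq_fun do rewrite /carry mulrBr big_distrr/=.
apply: asummableB.
  apply: asummable_sum => i _.
  have iN : (1 <= i.+1 <= N)%N by have := ltn_ord i; lia.
  under eq_fun do rewrite mulrCA mulrC.
  apply: (asummableM (K := 1)); first exact: asummable_slope.
  by move=> j _; exact: norm_sub_step.
under eq_fun do rewrite mulrCA mulrC.
apply: (asummableM (K := 1)); first exact: asummable_slope.
by move=> j _; exact: norm_step.
Qed.

Definition mean_carry (n : nat) (x : R) : R :=
  sum_over (letters S) (fun j => prob S j * carry n j x).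

(** Passing from one piece to the next adds the right end of the former and
    moves the left end: the increment at z_{n+1} is the term that [jump] sums. *)
Lemma mean_carryS n x : (n.+1 < N)%N ->
  mean_carry n.+1 x - mean_carry n x =
  sum_over (letters S) (fun l =>
    prob S l / slope S n.+1 l * step x (left_value S n.+1 l) -
    prob S l / slope S n.+2 l * step x (right_value S n.+1 l)).
Proof.
move=> nN; rewrite /mean_carry -sum_overB; last 2 first.
- exact: asummable_carry.
- by apply: asummable_carry; exact: ltnW.
apply: eq_sum_over => j _; rewrite -mulrBr /carry big_ord_recr/=.
set s := \sum_(_ < n) _; ring.
Qed.

(** * The signed measure behind [h_gamma] *)

Section Jumps.
Context (gamma : 'cV[R]_N.-1).

(** The one-sided values from which [h_gamma] starts are indexed by cut point,
    side ([true] for the left) and letter. *)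
Definition sources : set ('I_N.-1 * bool * nat) :=
  [set: 'I_N.-1 * bool] `*` letters S.

Definition source_point (s : 'I_N.-1 * bool * nat) : R :=
  if s.1.2 then left_value S s.1.1.+1 s.2 else right_value S s.1.1.+1 s.2.

Definition source_piece (mb : 'I_N.-1 * bool) : nat :=
  if mb.2 then mb.1.+1 else mb.1.+2.

Definition source_weight (s : 'I_N.-1 * bool * nat) : R :=
  (if s.1.2 then gamma s.1.1 0 else - gamma s.1.1 0) *
  (prob S s.2 / slope S (source_piece s.1) s.2).

(** The integral of [F] against the measure that puts the coefficients of
    [h_gamma] at the one-sided values. *)
Definition jump (F : R -> R) : R :=
  sum_over sources (fun s => source_weight s * F (source_point s)).

(** The integral of [g] against the measure of which [h_gamma] is the tail
    function. *)
Definition nu (g : R -> R) : R := jump (resolvent g).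

Lemma source_pieceP mb : (1 <= source_piece mb <= N)%N.
Proof.
case: mb => m b; rewrite /source_piece /=; have := ltn_ord m.
by case: b => /=; lia.
Qed.

Lemma source_unit s : sources s -> X (source_point s).
Proof.
case: s => -[m b] l [_ /= Ll]; rewrite /source_point /=; have := ltn_ord m.
case: b => mN; first by apply: left_value_unit => //; lia.
by apply: right_value_unit => //; lia.
Qed.

Lemma asummable_source : asummable sources source_weight.
Proof.
apply: (@asummable_pair _ _ _ _ _
  (fun mb : 'I_N.-1 * bool => if mb.2 then gamma mb.1 0 else - gamma mb.1 0)
  (fun s => prob S s.2 / slope S (source_piece s.1) s.2) rho).
- exact: ltW.
- exact: asummable_fin.
- by move=> mb _ /=; exact: (esum_slope (source_pieceP mb)).
Qed.

Lemma jumpE (F : R -> R) (K : R) : (forall u, X u -> `|F u| <= K) ->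
  jump F = \sum_(m < N.-1) gamma m 0 * sum_over (letters S) (fun l =>
    prob S l / slope S m.+1 l * F (left_value S m.+1 l) -
    prob S l / slope S m.+2 l * F (right_value S m.+1 l)).
Proof.
move=> FK; have sF : asummable sources (fun s => source_weight s * F (source_point s)).
  apply: (asummableM (K := K)); first exact: asummable_source.
  by move=> s /source_unit/FK.
rewrite /jump sum_over_pair// sum_over_fin.
have sl (mb : 'I_N.-1 * bool) : asummable (letters S)
    (fun l => prob S l / slope S (source_piece mb) l * F (source_point (mb, l))).
  apply: (asummableM (K := K)); first exact/asummable_slope/source_pieceP.
  by move=> l Ll; apply/FK/source_unit.
rewrite (eq_bigr (fun mb : 'I_N.-1 * bool =>
    (if mb.2 then gamma mb.1 0 else - gamma mb.1 0) * sum_over (letters S)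
    (fun l => prob S l / slope S (source_piece mb) l *
              F (source_point (mb, l))))); last first.
  move=> mb _; rewrite -sum_overZ//; apply: eq_sum_over => l _.
  by rewrite /source_weight/= -mulrA.
rewrite -(pair_bigA _ (fun m (b : bool) => (if b then gamma m 0 else - gamma m 0) *
  sum_over (letters S) (fun l => prob S l / slope S (source_piece (m, b)) l *
                                 F (source_point ((m, b), l)))))/=.
apply: eq_bigr => m _; rewrite big_bool/= mulNr -mulrBr; congr (_ * _).
by rewrite -sum_overB//.
Qed.

(** Countable linear combinations pass through both of the sums that make up
    [nu]. *)
Lemma nu_sum (T : choiceType) (D : set T) (b : T -> R) (f : T -> R -> R) (K : R) :
  asummable D b -> (forall j u, D j -> X u -> `|f j u| <= K) ->
  nu (fun u => sum_over D (fun j => b j * f j u)) =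
  sum_over D (fun j => b j * nu (f j)).
Proof.
move=> sb fK.
rewrite /nu /jump (@eq_sum_over _ _ _ _ (fun s => source_weight s *
    sum_over D (fun j => b j * resolvent (f j) (source_point s)))); last first.
  move=> s /source_unit Xs; congr (_ * _); rewrite /resolvent.
  apply: (exchange_sum_over (K := K)) => //; first exact: asummable_weight.
  by move=> w j Ww Dj; apply: fK => //; exact: word_map_unit.
apply: (exchange_sum_over (K := K * resolvent_bound)) => //.
  exact: asummable_source.
by move=> s j /source_unit Xs Dj; apply: norm_resolvent => // u Xu; exact: fK.
Qed.

Lemma nuD (g g' : R -> R) (K K' : R) :
  (forall u, X u -> `|g u| <= K) -> (forall u, X u -> `|g' u| <= K') ->
  nu (fun u => g u + g' u) = nu g + nu g'.
Proof.
move=> gK gK'; rewrite /nu /jump -sum_overD; last 2 first.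
- apply: (asummableM (K := K * resolvent_bound)); first exact: asummable_source.
  by move=> s /source_unit Xs; apply: norm_resolvent.
- apply: (asummableM (K := K' * resolvent_bound)); first exact: asummable_source.
  by move=> s /source_unit Xs; apply: norm_resolvent.
apply: eq_sum_over => s /source_unit Xs; rewrite -mulrDr; congr (_ * _).
rewrite /resolvent -sum_overD; last 2 first.
- exact: asummable_resolvent gK.
- exact: asummable_resolvent gK'.
by apply: eq_sum_over => w _; rewrite mulrDr.
Qed.

Lemma nu_transfer (g : R -> R) (K : R) : (forall u, X u -> `|g u| <= K) ->
  nu (transfer g) = nu g - jump g.
Proof.
move=> gK; rewrite /nu /jump -sum_overB; last 2 first.
- apply: (asummableM (K := K * resolvent_bound)); first exact: asummable_source.
  by move=> s /source_unit Xs; apply: norm_resolvent.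
- apply: (asummableM (K := K)); first exact: asummable_source.
  by move=> s /source_unit Xs; exact: gK.
apply: eq_sum_over => s /source_unit Xs.
by rewrite (resolvent_transfer Xs gK) mulrBr.
Qed.

Lemma h_gamma_nu x : X x -> h_gamma gamma x = nu (step x).
Proof.
move=> Xx; rewrite /nu (jumpE (K := 1 * resolvent_bound)); last first.
  by move=> u Xu; apply: norm_resolvent => // v _; exact: norm_step.
apply: eq_bigr => m _; congr (_ * _); apply: eq_sum_over => l Ll.
have mN := ltn_ord m.
rewrite !L_resolvent//; last by apply: left_value_unit => //; lia.
by apply: right_value_unit => //; lia.
Qed.

(** The coordinates of [gamma], numbered like the cut points and extended by
    zero to the end points of the unit interval. *)
Definition cut_weight (k : nat) : R := \sum_(m < N.-1 | m.+1 == k) gamma m 0.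

Lemma cut_weight0 : cut_weight 0 = 0.
Proof. by rewrite /cut_weight big_pred0. Qed.

Lemma cut_weight_npieces : cut_weight N = 0.
Proof. by rewrite /cut_weight big_pred0// => m; have := ltn_ord m; lia. Qed.

Lemma cut_weightE (m : 'I_N.-1) : cut_weight m.+1 = gamma m 0.
Proof. by rewrite /cut_weight (eq_bigl (pred1 m)) ?big_pred1_eq. Qed.

Context (hA5 : A5 S) (hgamma : fundamental_matrix S *m gamma = 0).

Lemma norm_indic (A : set R) (u : R) : `|\1_A u| <= 1 :> R.
Proof. by rewrite indicE; case: (_ \in _); rewrite ?normr1 ?normr0. Qed.

(** The equations [M gamma = 0] have the common factor [mean_invslope S n] in
    row [n]: it comes from [KI_resolvent] in the first part of the matrix entries
    and is present in their second part. By (A5) it can be cancelled. *)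
Lemma nu_piece n : (1 <= n <= N)%N -> nu \1_(piece S n) = cut_weight n.-1 - cut_weight n.
Proof.
case: n => // n nN.
have := congr1 (fun A : 'cV[R]_N => A (Ordinal (nN : (n < N)%N)) 0) hgamma.
rewrite !mxE /=.
rewrite (eq_bigr (fun m : 'I_N.-1 => gamma m 0 * sum_over (letters S) (fun j =>
    prob S j / slope S m.+1 j * KI S n.+1 (left_value S m.+1 j) -
    prob S j / slope S m.+2 j * KI S n.+1 (right_value S m.+1 j)) +
    mean_invslope S n.+1 *
      (gamma m 0 *+ (m.+1 == n.+1) - gamma m 0 *+ (m.+1 == n)))); last first.
  move=> m _; rewrite !mxE /fund_entry /= mulrC mulrDr; congr (_ + _).
  rewrite !eqSS (eq_sym n m) (eq_sym n m.+1).
  case: (eqVneq (m : nat) n) => [->|_].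
    by rewrite (gtn_eqF (ltnSn n)) mulr1n mulr0n subr0 mulrC.
  case: (eqVneq m.+1 n) => [->|_]; last by rewrite !mulr0n subrr !mulr0.
  by rewrite mulr0n mulr1n sub0r !mulrN mulrC.
have cut_weightM k : \sum_(m < N.-1) gamma m 0 *+ (m.+1 == k) = cut_weight k.
  by rewrite /cut_weight [RHS]big_mkcond; apply: eq_bigr => m _; rewrite mulrb.
rewrite big_split/= -big_distrr/= sumrB (cut_weightM n.+1) (cut_weightM n).
have KI_bound u : X u ->
    `|KI S n.+1 u| <= `|mean_invslope S n.+1| * (1 * resolvent_bound).
  move=> Xu; rewrite KI_resolvent// normrM ler_wpM2l//.
  by apply: norm_resolvent => // v _; exact: norm_indic.
rewrite -(jumpE KI_bound).
have -> : jump (KI S n.+1) = mean_invslope S n.+1 * nu \1_(piece S n.+1).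
  rewrite /nu /jump -sum_overZ; last first.
    apply: (asummableM (K := 1 * resolvent_bound)); first exact: asummable_source.
    by move=> s /source_unit Xs; apply: norm_resolvent => // v _; exact: norm_indic.
  apply: eq_sum_over => s /source_unit Xs.
  by rewrite KI_resolvent// mulrCA.
rewrite -mulrDr => /eqP; rewrite mulf_eq0 (negbTE (hA5 nN)) /= => /eqP.
by lra.
Qed.

(** * Invariance *)

Lemma orbit_source s : sources s -> orbit (source_point s).
Proof.
case: s => -[m b] l [_ /= Ll]; rewrite /source_point /=; have := ltn_ord m.
case: b => mN; first by apply: orbit_left => //; lia.
by apply: orbit_right => //; lia.
Qed.

Lemma eq_nu (g g' : R -> R) : (forall u, orbit u -> g u = g' u) -> nu g = nu g'.
Proof.
move=> gg'; apply: eq_sum_over => s /orbit_source os; congr (_ * _).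
by apply: eq_sum_over => w Ww; rewrite gg'//; exact: orbit_word_map.
Qed.

(** Summation by parts. *)
Lemma abel_sum (c g : nat -> R) n :
  \sum_(i < n.+1) c i * (g i - g i.+1) =
  c 0%N * g 0%N - c n * g n.+1 + \sum_(i < n) g i.+1 * (c i.+1 - c i).
Proof.
elim: n => [|n IH]; first by rewrite big_ord_recl !big_ord0 /=; ring.
rewrite big_ord_recr IH [in RHS]big_ord_recr /=; ring.
Qed.

Lemma npieces_gt0 : (0 < N)%N.
Proof.
case: hA1 => -[c0 cN _] _ _ _; rewrite lt0n; apply/eqP => N0.
by move: cN; rewrite N0 c0 => /eqP; rewrite eq_sym oner_eq0.
Qed.

(** The operator at [x] is integrated against [nu] under the integral sign,
    where [branch_step] splits it into the transfer operator and a function that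
    is constant on pieces; summation by parts against the masses of the pieces
    cancels the boundary term of [nu_transfer]. *)
Lemma PF_h_gamma x : X x -> ~ orbit x -> PF S (h_gamma gamma) x = h_gamma gamma x.
Proof.
move=> Xx ox.
(* Indexing by the letter first matches the sum that defines the operator, and
   the opposite order the bound of (A2). *)
pose E : set (nat * 'I_N) := letters S `*` [set: 'I_N].
pose hit (k : nat * 'I_N) : bool :=
  (cut S k.2 < preimage k.2.+1 k.1 x < cut S k.2.+1)%R.
pose b (k : nat * 'I_N) : R := prob S k.1 * ((hit k)%:R / `|slope S k.2.+1 k.1|).
pose f (k : nat * 'I_N) : R -> R := step (preimage k.2.+1 k.1 x).
have sb : asummable E b.
  apply/(asummable_bij b (set_bij_swap [set: 'I_N] (letters S))).
  apply: (@asummable_le _ _ _ _ (fun k : 'I_N * nat =>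
      1 * (prob S k.2 / slope S k.1.+1 k.2))); last first.
    move=> [i j] [_ /= Lj]; rewrite /b/= mul1r mulrCA normrM.
    rewrite [leRHS]normrM normfV [leLHS]mulrC normrM normfV normr_id.
    by apply: ler_piMr => //; case: (hit _); rewrite ?normr1 ?normr0.
  apply: (@asummable_pair _ _ _ _ _ (cst 1)
    (fun k : 'I_N * nat => prob S k.2 / slope S k.1.+1 k.2) rho).
  - exact: ltW.
  - exact: asummable_fin.
  - by move=> i _ /=; exact: (@esum_slope i.+1 (ltn_ord i)).
have fb k u : E k -> X u -> `|f k u| <= 1 by move=> _ _; exact: norm_step.
have -> : PF S (h_gamma gamma) x = sum_over E (fun k => b k * nu (f k)).
  rewrite sum_over_pair; last first.
    apply: (asummableM (K := 1 * resolvent_bound *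
        fine (\esum_(s in sources) `|(source_weight s)%:E|)%E)) => // k _.
    apply: norm_sum_overM.
    - by rewrite mul1r resolvent_bound_ge0.
    - rewrite fineK// ge0_fin_numE ?esum_ge0//; exact: asummable_source.
    - by move=> s /source_unit Xs; apply: norm_resolvent => // u _; exact: norm_step.
  apply: eq_sum_over => j Lj; rewrite PF_mapE// big_distrr sum_over_fin /=.
  apply: eq_bigr => i _; rewrite /b /hit /f /=.
  case: (boolP (_ < _ < _)%R) => [hi|_]; last by rewrite !mul0r mulr0 mul0r.
  have iN1 : (1 <= i.+1 <= N)%N by exact: (ltn_ord i).
  rewrite h_gamma_nu; first by rewrite !mul1r mulrAC mulrA.
  apply: (piece_unit iN1); exact/piece_preimage.
rewrite -(nu_sum sb fb).
have mc (i : 'I_N) u : X u -> `|\1_(piece S i.+1) u| <= 1 :> R.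
  by move=> _; exact: norm_indic.
rewrite (@eq_nu _ (fun u => transfer (step x) u +
    sum_over [set: 'I_N] (fun i => mean_carry i x * \1_(piece S i.+1) u))); last first.
  move=> u ou; have Xu := orbit_unit ou.
  have [[//|n] nN pu] := piece_cover Xu.
  have nN' : (n < N)%N by case/andP: nN.
  rewrite sum_over_pair; last by apply: (asummableM (K := 1)) => // k Ek; exact: fb.
  rewrite [X in _ + X]sum_over_fin (bigD1 (Ordinal nN'))//= big1 ?addr0; last first.
    move=> i /eqP inn; rewrite indicE; case: (boolP (_ \in _)) => [/set_mem pi|_].
      case: inn; apply/val_inj => /=.
      by have [] := piece_inj (ltn_ord i : (1 <= i.+1 <= N)%N) nN pi pu.
    by rewrite mulr0.
  rewrite indicE mem_set// mulr1 /transfer /mean_carry -sum_overD; last 2 first.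
  - apply: (asummableM (K := 1)); first exact: asummable_inv_slope.
    by move=> j _; exact: norm_step.
  - exact: asummable_carry.
  apply: eq_sum_over => j Lj; rewrite sum_over_fin.
  rewrite (inv_slopeE _ nN pu) -mulrA -mulrDr [_^-1 * _]mulrC -branch_step//.
  rewrite big_distrr/=; apply: eq_bigr => i _.
  by rewrite /b /hit /f /= !mulrA.
rewrite (nuD (K := 1 * rho)
    (K' := \sum_(i < N) `|mean_carry i x|)); last 2 first.
- by move=> u Xu; apply: bounded_transfer => // v _; exact: norm_step.
- move=> u Xu; rewrite sum_over_fin; apply: le_trans (ler_norm_sum _ _ _) _.
  by apply: ler_sum => i _; rewrite normrM ler_piMr// norm_indic.
rewrite (nu_sum (K := 1)); last 2 first.
- exact: asummable_fin.
- by move=> i u _ Xu; exact: mc.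
rewrite sum_over_fin (nu_transfer (K := 1)); last by move=> u _; exact: norm_step.
rewrite h_gamma_nu// -addrA -[RHS]addr0; congr (_ + _).
under eq_bigr => i _ do rewrite (nu_piece (ltn_ord i : (1 <= i.+1 <= N)%N)).
rewrite (jumpE (K := 1)); last by move=> u _; exact: norm_step.
rewrite -(big_mkord xpredT (fun i => mean_carry i x * (cut_weight i - cut_weight i.+1))).
rewrite -[X in \sum_(0 <= i < X) _](prednK npieces_gt0) big_mkord.
rewrite (abel_sum (fun i => mean_carry i x) cut_weight).
rewrite cut_weight0 prednK ?npieces_gt0// cut_weight_npieces !mulr0 subrr add0r.
apply/eqP; rewrite addrC subr_eq0; apply/eqP; apply: eq_bigr => m _.
by rewrite cut_weightE mean_carryS//; have := ltn_ord m; lia.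
Qed.

Lemma norm_nu (g : R -> R) (K : R) : 0 <= K -> (forall u, X u -> `|g u| <= K) ->
  `|nu g| <= K * resolvent_bound * fine (\esum_(s in sources) `|(source_weight s)%:E|)%E.
Proof.
move=> K0 gK; apply: norm_sum_overM.
- by rewrite mulr_ge0// resolvent_bound_ge0.
- rewrite fineK// ge0_fin_numE ?esum_ge0//; exact: asummable_source.
- by move=> s /source_unit Xs; exact: norm_resolvent.
Qed.

Lemma measurable_step (u : R) : measurable_fun [set: R] (step^~ u).
Proof.
rewrite (_ : step^~ u = \1_(`]-oo, u[%classic)); first exact: measurable_indic.
by apply/funext => x; rewrite indicE mem_setE /= in_itv.
Qed.

Lemma measurable_nu_step : measurable_fun [set: R] (fun x => nu (step x)).
Proof.
apply: measurable_sum_over => s; apply: measurable_funM; first exact: measurable_cst.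
apply: measurable_sum_over => w; apply: measurable_funM; first exact: measurable_cst.
exact: measurable_step.
Qed.

Lemma L1_h_gamma : L1_01 (h_gamma gamma).
Proof.
rewrite /L1_01; apply: measurable_bounded_integrable => //.
- by rewrite /= lebesgue_measure_itv /= lte_fin ltr01 -EFinB ltry.
- apply: (@eq_measurable_fun _ _ _ _ _ (fun x => nu (step x))).
    by move=> x /set_mem Xx; rewrite h_gamma_nu.
  exact: measurable_funTS measurable_nu_step.
pose B := 1 * resolvent_bound * fine (\esum_(s in sources) `|(source_weight s)%:E|)%E.
exists B; split; first exact: num_real.
move=> M BM x Xx; rewrite /= h_gamma_nu//; apply: le_trans (ltW BM).
by apply: norm_nu => // u _; exact: norm_step.
Qed.

Lemma T_invariant_h_gamma : T_invariant S (h_gamma gamma).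
Proof.
split; first exact: L1_h_gamma.
exists orbit; split.
- by apply: countable_measurable => //; exact: countable_orbit.
- by apply: countable_lebesgue_measure0; exact: countable_orbit.
move=> x /= /not_implyP[Xx neq]; apply: contrapT => ox.
by apply: neq; exact: PF_h_gamma.
Qed.

(** * Non-triviality *)

(** Dominated convergence, first over words and then over one-sided values. *)
Lemma nu_cvg0 (f : nat -> R -> R) (K : R) :
  (forall k u, X u -> `|f k u| <= K) ->
  (forall u, X u -> f^~ u @ \oo --> (0 : R)) ->
  (fun k => nu (f k)) @ \oo --> (0 : R).
Proof.
move=> fK f0; apply: (cvg_sum_over0 (K := K * resolvent_bound)).
  exact: asummable_source.
  by move=> k s /source_unit Xs; apply: norm_resolvent => // u; exact: fK.
move=> s /source_unit Xs; apply: (cvg_sum_over0 (K := K)).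
- exact: asummable_weight.
- by move=> k w Ww; apply: fK; exact: word_map_unit.
- by move=> w Ww; apply: f0; exact: word_map_unit.
Qed.

(** If the tails of [nu] at the points [x k] vanish, so does the mass that
    they approach. *)
Lemma nu_limit (x : nat -> R) (J : R -> R) : (forall k, nu (step (x k)) = 0) ->
  (forall u, X u -> `|J u| <= 1) ->
  (forall u, X u -> \forall k \near \oo, step (x k) u = J u) -> nu J = 0.
Proof.
move=> hx J1 xJ.
have nuE k : nu (fun u => J u - step (x k) u) = nu J.
  have := @nuD (fun u => J u - step (x k) u) (step (x k)) 2 1.
  rewrite hx addr0 => <-.
  - by congr nu; apply/funext => u; rewrite subrK.
  - move=> u Xu; apply: le_trans (ler_normB _ _) _.
    by rewrite (lerD (J1 u Xu) (norm_step _ _)).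
  - by move=> u _; exact: norm_step.
have := @nu_cvg0 (fun k u => J u - step (x k) u) 2.
rewrite (_ : (fun k => nu _) = cst (nu J)); last exact/funext.
move=> /(_ _ _)/cvg_lim; rewrite lim_cst// => -> //.
- move=> k u Xu; apply: le_trans (ler_normB _ _) _.
  by rewrite (lerD (J1 u Xu) (norm_step _ _)).
- move=> u Xu; apply: cvg_near_cst; have := xJ u Xu.
  by apply: filterS => k ->; rewrite subrr.
Qed.

(** A nonempty open interval has positive measure. *)
Lemma ae_itv_ex (P : set R) (a b : R) : a < b -> `]a, b[%classic `<=` X ->
  {ae (@lebesgue_measure R), forall x, X x -> P x} ->
  exists2 x, a < x < b & P x.
Proof.
move=> ab abX [A [mA A0 PA]]; apply: contrapT => noP.
have abA : `]a, b[%classic `<=` A.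
  move=> x xI; apply: PA => /= /(_ (abX x xI)) Px; apply: noP.
  by exists x => //; move: xI; rewrite /= in_itv.
have : (@lebesgue_measure R `]a, b[%classic <= @lebesgue_measure R A)%E.
  by apply: le_measure => //; rewrite inE.
rewrite (_ : @lebesgue_measure R A = 0%E)// lebesgue_measure_itv /= lte_fin ab.
by rewrite -EFinB lee_fin subr_le0 leNgt ab.
Qed.

(** The mass of the union of the pieces [I_{n+1}, ..., I_N] is a limit of
    tails of [nu] and telescopes to gamma_n. *)
Lemma not_eq_L1_0 : gamma != 0 -> ~ eq_L1_01 (h_gamma gamma) (cst 0).
Proof.
move=> /eqP gamma0 h0; apply: gamma0; apply/matrixP => m i.
rewrite mxE [i]ord1 {i} -cut_weightE; set n := m.+1.
have nN : (0 < n < N)%N by rewrite /n; have := ltn_ord m; lia.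
have [n_gt0 n_ltN] := andP nN.
set z := cut S n.
have cut0 : cut S 0 = 0 by case: hA1 => -[].
have cutN : cut S N = 1 by case: hA1 => -[].
have z0 : 0 < z.
  rewrite -cut0 /z; apply: lt_le_trans (cut_lt _) (cut_le _); lia.
have z1 : z < 1.
  rewrite -cutN /z; apply: lt_le_trans (cut_lt n_ltN) (cut_le _); lia.
pose J (u : R) : R := sum_over [set: 'I_N]
  (fun i => (n <= i)%N%:R * \1_(piece S i.+1) u).
have JE p u : (1 <= p <= N)%N -> piece S p u -> J u = (n < p)%N%:R.
  case: p => [//|p] pN pu; have pN' : (p < N)%N by [].
  rewrite /J sum_over_fin (bigD1 (Ordinal pN'))//= big1 ?addr0.
    by rewrite indicE mem_set// mulr1.
  move=> k /eqP kp; rewrite indicE; case: (boolP (_ \in _)) => [/set_mem pk|_].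
    case: kp; apply/val_inj => /=.
    by have [] := piece_inj (ltn_ord k : (1 <= k.+1 <= N)%N) pN pk pu.
  by rewrite mulr0.
have J1 u : X u -> `|J u| <= 1.
  by move=> /piece_cover[p pN /(JE p u pN)->]; case: (_ < _)%N; rewrite ?normr1 ?normr0.
have nuJ : nu J = cut_weight n.
  rewrite /J (nu_sum (K := 1)); last 2 first.
  - exact: asummable_fin.
  - by move=> k u _ _; exact: norm_indic.
  rewrite sum_over_fin.
  under eq_bigr => k _ do rewrite (nu_piece (ltn_ord k : (1 <= k.+1 <= N)%N)) /=.
  rewrite -(big_mkord xpredT (fun k => (n <= k)%N%:R * (cut_weight k - cut_weight k.+1))).
  rewrite (big_cat_nat _ (n := n))//=; last exact: ltnW.
  rewrite big1_seq ?add0r; last first.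
    by move=> k; rewrite mem_index_iota /= => kn; rewrite leqNgt kn mul0r.
  rewrite (@telescope_sumr_eq _ _ _ (fun k => - cut_weight k)); last 2 first.
  - exact: ltnW.
  - by move=> k /andP[-> _]; rewrite mul1r opprK addrC.
  by rewrite cut_weight_npieces oppr0 add0r opprK.
rewrite -nuJ.
(* On the unit interval [J] is the indicator of [[z, 1]] or of ]z, 1], depending
   on the piece that contains [z]. *)
have uz p u : (1 <= p <= N)%N -> piece S p u -> (n < p)%N -> z <= u.
  move=> pN pu np; have := (piece_itv pN).2 _ pu; rewrite /= in_itv /= => /andP[+ _].
  by apply: le_trans; apply: cut_le; lia.
have zu p u : (1 <= p <= N)%N -> piece S p u -> (p <= n)%N -> u <= z.
  move=> pN pu np; have := (piece_itv pN).2 _ pu; rewrite /= in_itv /= => /andP[_].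
  by move=> /le_trans; apply; apply: cut_le; lia.
have h0' : {ae (@lebesgue_measure R), forall x, X x -> nu (step x) = 0}.
  by apply: filterS h0 => x hx Xx; rewrite -h_gamma_nu// hx.
have harm (c : R) : (fun k => z + c * harmonic k) @ \oo --> z.
  rewrite -[X in _ --> X]addr0 -[X in _ + X](mulr0 c).
  by apply: cvgD; [exact: cvg_cst|apply: cvgMr; exact: cvg_harmonic].
have harm_gt0 k : 0 < (harmonic k : R) by rewrite invr_gt0.
have harm_le1 k : (harmonic k : R) <= 1 by rewrite invf_le1// ler1n.
have nN1 : (1 <= n.+1 <= N)%N by [].
(* If [z] lies in the piece on its right, the tails approach from the left of
   [z], so that they keep the atom at [z]; otherwise from the right. *)
have [zn|zn] := pselect (piece S n.+1 z).
- have /choice[x xP] : forall k, exists x,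
      (z + - z * harmonic k < x < z) /\ nu (step x) = 0.
    move=> k; have [||x xI nx] := @ae_itv_ex _ (z + - z * harmonic k) z _ _ h0'.
    + by rewrite gtrDl mulNr oppr_lt0 mulr_gt0.
    + move=> x; rewrite /= !in_itv /= => /andP[xl xr].
      rewrite (le_trans (ltW xr) (ltW z1)) andbT.
      apply: le_trans (ltW xl); rewrite mulNr subr_ge0 ger_pMr// harm_le1//.
    by exists x.
  have xz : x @ \oo --> z.
    apply: (squeeze_cvgr _ (harm (- z)) (cvg_cst z)).
    by apply: nearW => k; have [/andP[/ltW-> /ltW->]] := xP k.
  apply: (nu_limit (x := x)) => // [k|u Xu]; first by have [] := xP k.
  have [p pN pu] := piece_cover Xu; rewrite (JE p u pN pu).
  have [np|pn] := ltnP n p.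
    apply: nearW => k; rewrite /step (lt_le_trans _ (uz p u pN pu np))//.
    by have [/andP[]] := xP k.
  have uz' : u < z.
    rewrite lt_neqAle (zu p u pN pu pn) andbT; apply/eqP => uE.
    by rewrite uE in pu; have := piece_inj pN nN1 pu zn; lia.
  near=> k; have uxk : u < x k by near: k; exact: (cvgr_gt z xz).
  by rewrite /step ltNge (ltW uxk).
- have /choice[x xP] : forall k, exists x,
      (z < x < z + (1 - z) * harmonic k) /\ nu (step x) = 0.
    move=> k; have [||x xI nx] := @ae_itv_ex _ z (z + (1 - z) * harmonic k) _ _ h0'.
    + by rewrite ltrDl mulr_gt0// subr_gt0.
    + move=> x; rewrite /= !in_itv /= => /andP[xl xr].
      rewrite (le_trans (ltW z0) (ltW xl))/=.
      apply: le_trans (ltW xr) _; rewrite -lerBrDl ger_pMr ?subr_gt0// harm_le1//.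
    by exists x.
  have xz : x @ \oo --> z.
    apply: (squeeze_cvgr _ (cvg_cst z) (harm (1 - z))).
    by apply: nearW => k; have [/andP[/ltW-> /ltW->]] := xP k.
  apply: (nu_limit (x := x)) => // [k|u Xu]; first by have [] := xP k.
  have [p pN pu] := piece_cover Xu; rewrite (JE p u pN pu).
  have [np|pn] := ltnP n p; last first.
    apply: nearW => k; rewrite /step ltNge (le_trans (zu p u pN pu pn))//.
    by have [/andP[/ltW]] := xP k.
  have uz' : z < u.
    rewrite lt_neqAle (uz p u pN pu np) andbT; apply/eqP => uE.
    rewrite -uE in pu.
    case: (ltnP n.+1 p) => [np'|pn']; last first.
      by apply: zn; have <- : p = n.+1 by lia.
    have := (piece_itv pN).2 _ pu; rewrite /= in_itv /= => /andP[+ _].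
    apply/negP; rewrite -ltNge; apply: lt_le_trans (cut_lt n_ltN) (cut_le _); lia.
  near=> k; have xku : x k < u by near: k; exact: (cvgr_lt z xz).
  by rewrite /step xku.
Unshelve. all: by end_near. Qed.

End Jumps.

End RandomSystem.

Theorem theorem4p1 (R : realType) (S : random_pl R)
  (hS : random_system S)
  (hA1 : A1 S) (hA2 : A2 S) (hA3 : A3 S) (hA4 : A4 S) (hA5 : A5 S)
  (gamma : 'cV[R]_(npieces S).-1)
  (hgamma : fundamental_matrix S *m gamma = 0)
  (gamma_neq0 : gamma != 0) :
  T_invariant S (h_gamma gamma) /\ ~ eq_L1_01 (h_gamma gamma) (cst 0).
Proof.
have [rho [rho0 rho1 hrho]] := hA2; split.
- exact: (T_invariant_h_gamma hS hA1 rho0 rho1 hrho hA5 hgamma).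
- exact: (not_eq_L1_0 hS hA1 rho0 rho1 hrho hA5 hgamma).
Qed.
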